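(* For relations $R_1,R_2,R_3\in\{\leq,\geq,<,>,=,\neq,-\}$ let $I_{(R_1,R_2,R_3)}(z,t)=\sum_{n\ge0}\sum_{e\in\mathbf{I}_n(R_1,R_2,R_3)}z^nt^{\mathrm{dist}(e)}$. Then $$I_{(<,-,<)}(z,t)=\frac{1-3z+zt+3z^2-2z^2t+z^2t^2-z^3+z^3t}{(1-z)^3},$$ $$I_{(\neq,<,-)}(z,t)=\frac{1-4z+zt+6z^2-4z^2t+z^2t^2-4z^3+5z^3t-z^3t^2+z^4-2z^4t+z^4t^2}{(1-z)^2(1-2z+z^2-z^2t)},$$ $$I_{(\neq,\leq,-)}(z,t)=\frac{1-2z+zt+z^2-2z^2t+z^2t^2+z^3t}{(1-z)(1-z-z^2t)},$$ $$I_{(>,<,-)}(z,t)=\frac{1+z(2-t)-z^2(1-t)-(1-z)\sqrt{(1+z-zt)^2-\frac{4z(1-z+zt)}{1-z}}}{2z(2-z)},$$ $$I_{(>,\leq,-)}(z,t)=\frac{1+z(3-t)-\sqrt{1-z(2+2t-z+6zt-zt^2)}}{4z},$$ $$I_{(>,\neq,-)}(z,t)=\frac{1-2z+z^2(1-t)^2+(1-z+zt)\sqrt{(1+z-zt)^2-4z}}{2(1-z)\sqrt{(1+z-zt)^2-4z}},$$ $$I_{(\geq,\neq,-)}(z,t)=\frac{1-z-zt+2z^2t}{(1-z)(1-zt)^2},\qquad I_{(=,<,-)}(z,t)=\frac{1-z}{1-z-zt},$$ $$I_{(=,\leq,-)}(z,t)=\frac{1}{1-zt-z^2t},\qquad 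I_{(\geq,\leq,\neq)}(z,t)=\frac{1-z+z^3t}{(1-z)(1-zt-z^2t)}.$$
   Context: An inversion sequence of length $n$ is an integer sequence $e=e_1\dots e_n$ with $0\le e_i<i$ for all $i$; $\mathbf{I}_n$ is the set of these, and $\mathbf{I}_0$ consists only of the empty sequence. For a triple of relations $(R_1,R_2,R_3)$ with each $R_i\in\{\leq,\geq,<,>,=,\neq,-\}$, where $-$ is the trivial relation ($x-y$ holds for all $x,y$), $\mathbf{I}_n(R_1,R_2,R_3)$ is the set of $e\in\mathbf{I}_n$ with no indices $i<j<k$ such that $e_iR_1e_j$, $e_jR_2e_k$ and $e_iR_3e_k$. For $e\in\mathbf{I}_n$, $\mathrm{dist}(e)=|\{e_1,\dots,e_n\}|$ is the number of distinct entries. *)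

(* Defs.v *)
From HB Require Import structures.
From mathcomp Require Import all_boot all_order all_algebra.
From mathcomp Require Import boolp classical_sets.

Set Implicit Arguments.
Unset Strict Implicit.
Unset Printing Implicit Defensive.

Import GRing.Theory.
Local Open Scope ring_scope.

(** * Formal power series *)

(* A record rather than a bare function, so that the Cauchy product does not
   compete with the pointwise product of functions. *)
Record fps (R : Type) := Fps { coefs : nat -> R }.

Lemma fpsP (R : Type) (f g : fps R) :
  (forall n, coefs f n = coefs g n) <-> f = g.
Proof.
split=> [|-> //]; case: f g => [f] [g] /= fg.
by congr Fps; apply: funext.
Qed.

HB.instance Definition _ (R : Type) := gen_eqMixin (fps R).
HB.instance Definition _ (R : Type) := gen_choiceMixin (fps R).

Section FpsZmodule.
Variable R : zmodType.
Implicit Types f g : fps R.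

Definition fps_zero : fps R := Fps (fun=> 0).
Definition fps_opp f : fps R := Fps (fun n => - coefs f n).
Definition fps_add f g : fps R := Fps (fun n => coefs f n + coefs g n).

Fact fps_addA : associative fps_add.
Proof. by move=> f g h; apply/fpsP=> n /=; rewrite addrA. Qed.
Fact fps_addC : commutative fps_add.
Proof. by move=> f g; apply/fpsP=> n /=; rewrite addrC. Qed.
Fact fps_add0 : left_id fps_zero fps_add.
Proof. by move=> f; apply/fpsP=> n /=; rewrite add0r. Qed.
Fact fps_addN : left_inverse fps_zero fps_opp fps_add.
Proof. by move=> f; apply/fpsP=> n /=; rewrite addNr. Qed.

HB.instance Definition _ :=
  GRing.isZmodule.Build (fps R) fps_addA fps_addC fps_add0 fps_addN.

Lemma coefs0 n : coefs (0 : fps R) n = 0. Proof. by []. Qed.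
Lemma coefsN f n : coefs (- f) n = - coefs f n. Proof. by []. Qed.
Lemma coefsD f g n : coefs (f + g) n = coefs f n + coefs g n.
Proof. by []. Qed.
Lemma coefsB f g n : coefs (f - g) n = coefs f n - coefs g n.
Proof. by []. Qed.

End FpsZmodule.

Section FpsRing.
Variable R : comNzRingType.
Implicit Types f g h : fps R.

Definition fpsC (c : R) : fps R := Fps (fun n => if n is 0 then c else 0).
Definition fpsX : fps R := Fps (fun n => (n == 1)%:R).
Definition fps_mul f g : fps R :=
  Fps (fun n => \sum_(i < n.+1) coefs f i * coefs g (n - i)).

Definition fps_trunc m f : {poly R} := \poly_(i < m) coefs f i.

Lemma coef_trunc_mul f g m n : (n < m)%N ->
  coefs (fps_mul f g) n = (fps_trunc m f * fps_trunc m g)`_n.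
Proof.
move=> lt_nm; rewrite coefM; apply: eq_bigr => i _.
have lt_im : (i < m)%N by apply: leq_ltn_trans lt_nm; rewrite -ltnS.
by rewrite !coef_poly lt_im (leq_ltn_trans (leq_subr i n) lt_nm).
Qed.

Fact fps_mulA : associative fps_mul.
Proof.
move=> f g h; apply/fpsP=> n.
transitivity (fps_trunc n.+1 f * (fps_trunc n.+1 g * fps_trunc n.+1 h))`_n.
  rewrite coefM; apply: eq_bigr => i _.
  by rewrite (@coef_trunc_mul _ _ n.+1) ?ltnS ?leq_subr // coef_poly ltn_ord.
rewrite mulrA coefM; apply: eq_bigr => i _.
by rewrite (@coef_trunc_mul _ _ n.+1) // coef_poly ltnS leq_subr.
Qed.

Fact fps_mulC : commutative fps_mul.
Proof.
move=> f g; apply/fpsP=> n.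
by rewrite !(@coef_trunc_mul _ _ n.+1) // mulrC.
Qed.

Fact fps_mul1 : left_id (fpsC 1) fps_mul.
Proof.
move=> f; apply/fpsP=> n /=.
by rewrite big_ord_recl big1 /= ?subn0 ?mul1r ?addr0 // => i _; rewrite mul0r.
Qed.

Fact fps_mulDl : left_distributive fps_mul +%R.
Proof.
move=> f g h; apply/fpsP=> n /=; rewrite -big_split /=.
by apply: eq_bigr => i _; rewrite mulrDl.
Qed.

Fact fps_1neq0 : fpsC 1 != 0.
Proof. by apply/eqP => /fpsP /(_ 0%N) /eqP; rewrite coefs0 oner_eq0. Qed.

HB.instance Definition _ := GRing.Zmodule_isComNzRing.Build (fps R)
  fps_mulA fps_mulC fps_mul1 fps_mulDl fps_1neq0.

Lemma coefs1 n : coefs (1 : fps R) n = (n == 0)%:R.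
Proof. by case: n. Qed.
Lemma coefsM f g n :
  coefs (f * g) n = \sum_(i < n.+1) coefs f i * coefs g (n - i).
Proof. by []. Qed.

Definition fps_unit : pred (fps R) := fun f => `[< exists g, g * f = 1 >].
Definition fps_inv f : fps R := xget f [set g | g * f = 1].

Fact fps_mulVf : {in fps_unit, left_inverse 1 fps_inv *%R}.
Proof.
move=> f /asboolP[g gf1].
by apply: (xgetPex f (P := [set g | g * f = 1])); exists g.
Qed.

Fact fps_unitP f g : g * f = 1 -> fps_unit f.
Proof. by move=> gf1; apply/asboolP; exists g. Qed.

Fact fps_inv_out : {in [predC fps_unit], fps_inv =1 id}.
Proof.
move=> f /asboolP nU; rewrite /fps_inv xgetPN // => g gf1.
by apply: nU; exists g.
Qed.

HB.instance Definition _ := GRing.ComNzRing_hasMulInverse.Build (fps R)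
  fps_mulVf fps_unitP fps_inv_out.

End FpsRing.

Notation "x %:F" := (@FracField.tofrac _ x) : ring_scope.

Section FpsIdomain.
Variable R : idomainType.
Implicit Types f g s : fps R.

Lemma fps_order f : f != 0 ->
  exists2 a, coefs f a != 0 & forall i, (i < a)%N -> coefs f i = 0.
Proof.
move=> f0; have exf : exists a, coefs f a != 0.
  apply: contrapT => nf; move/eqP: f0; apply; apply/fpsP=> n.
  by apply/eqP/negPn/negP=> fn; apply: nf; exists n.
case: (ex_minnP exf) => a fa mina; exists a => // i lt_ia.
by apply/eqP; apply: contraTT lt_ia => /mina; rewrite -leqNgt.
Qed.

Fact fps_mulf_eq0 f g : f * g = 0 -> (f == 0) || (g == 0).
Proof.
move=> fg0; apply: contrapT => /negP; rewrite negb_or => /andP[f0 g0].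
have [a fa mina] := fps_order f0; have [b gb minb] := fps_order g0.
have : coefs (f * g) (a + b)%N = 0 by rewrite fg0.
have lt_a : (a < (a + b).+1)%N by rewrite ltnS leq_addr.
rewrite coefsM (bigD1 (Ordinal lt_a)) //= addKn big1 ?addr0; last first.
  move=> i; rewrite -val_eqE /= neq_ltn => /orP[/mina ->|lt_ai].
    by rewrite mul0r.
  rewrite (minb (a + b - i)%N) ?mulr0 //.
  by rewrite ltn_subLR ?ltn_add2r // -ltnS ltn_ord.
by move/eqP; rewrite mulf_eq0 (negPf fa) (negPf gb).
Qed.

HB.instance Definition _ :=
  GRing.ComUnitRing_isIntegral.Build (fps R) fps_mulf_eq0.

(** * Square roots of power series, in the fraction field *)

(* For a power series x with constant coefficient 1: the unique power series
   with constant coefficient 1 whose square is x (see [series_sqrtE] and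
   [fps_sqrt_exists]); the junk value 0 if there is no such power series. *)
Definition series_sqrt (x : {fraction (fps R)}) : {fraction (fps R)} :=
  xget 0 [set y | exists s : fps R,
                    [/\ coefs s 0 = 1, s%:F ^+ 2 = x & y = s%:F]].

Lemma fps_sqrt_uniq s1 s2 : (2%:R : R) != 0 ->
  coefs s1 0 = 1 -> coefs s2 0 = 1 -> s1 ^+ 2 = s2 ^+ 2 -> s1 = s2.
Proof.
move=> two_neq0 c1 c2 /eqP; rewrite eqf_sqr => /orP[/eqP //|/eqP e].
have := two_neq0; rewrite -[2%:R]/(1 + 1) -{1}c1 -c2 e coefsN addNr.
by rewrite eqxx.
Qed.

Lemma series_sqrtE s : (2%:R : R) != 0 ->
  coefs s 0 = 1 -> series_sqrt ((s ^+ 2)%:F) = s%:F.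
Proof.
move=> two_neq0 c1; apply: xget_unique; first by exists s; rewrite rmorphXn.
move=> y [s' [c1' e ->]]; congr (FracField.tofrac _).
apply: fps_sqrt_uniq => //; apply/eqP.
by rewrite -tofrac_eq rmorphXn e.
Qed.

Lemma fps_sqrt_exists f : (2%:R : R) \is a GRing.unit -> coefs f 0 = 1 ->
  exists2 s : fps R, coefs s 0 = 1 & s ^+ 2 = f.
Proof.
move=> u2 f0.
pose next n (l : seq R) :=
  (coefs f n.+1 - \sum_(i < n) l`_i.+1 * l`_(n - i)) / 2%:R.
pose fix pre n : seq R :=
  if n is m.+1 then rcons (pre m) (next m (pre m)) else [:: 1].
have size_pre n : size (pre n) = n.+1.
  by elim: n => //= n IHn; rewrite size_rcons IHn.
have preE n m : (n <= m)%N -> (pre m)`_n = (pre n)`_n.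
  elim: m => [|m IHm]; first by rewrite leqn0 => /eqP->.
  rewrite leq_eqVlt => /orP[/eqP-> //|le_nm].
  by rewrite /= nth_rcons size_pre le_nm IHm.
exists (Fps (fun n => (pre n)`_n)) => //.
apply/fpsP=> -[|n]; rewrite expr2 coefsM.
  by rewrite big_ord_recl big_ord0 addr0 /= mulr1 f0.
rewrite big_ord_recl big_ord_recr /= subn0 subnn !nth_rcons !size_pre.
rewrite ltnn eqxx /= mul1r mulr1.
have -> : \sum_(i < n) (rcons (pre i) (next i (pre i)))`_(bump 0 i)
            * (pre (n.+1 - bump 0 i)%N)`_(n.+1 - bump 0 i)
        = \sum_(i < n) (pre n)`_i.+1 * (pre n)`_(n - i).
  apply: eq_bigr => i _; rewrite /bump /= add1n subSS.
  rewrite -[rcons _ _]/(pre i.+1) -(preE i.+1 n) ?ltn_ord //.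
  by rewrite (preE (n - i)%N n) ?leq_subr.
by rewrite addrCA -mulr2n -mulr_natr divrK // addrC subrK.
Qed.

End FpsIdomain.

(** * Pattern-avoiding inversion sequences *)

Inductive relsym := Rle | Rge | Rlt | Rgt | Req | Rne | Rany.

Definition holds (r : relsym) : rel nat :=
  match r with
  | Rle => fun x y => (x <= y)%N
  | Rge => fun x y => (x >= y)%N
  | Rlt => fun x y => (x < y)%N
  | Rgt => fun x y => (x > y)%N
  | Req => fun x y => x == y
  | Rne => fun x y => x != y
  | Rany => fun _ _ => true
  end.

Section InversionSequences.
Variable n : nat.
Implicit Type e : {ffun 'I_n -> 'I_n}.

(* With positions counted from 0, the condition e_i < i reads e i <= i; in
   particular all entries are smaller than n, so that 'I_n can be used both
   for positions and for entries. *)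
Definition inversion_seq e : bool := [forall i : 'I_n, (e i <= i)%N].

Definition contains (R1 R2 R3 : relsym) e : bool :=
  [exists i : 'I_n, exists j : 'I_n, exists k : 'I_n,
    [&& (i < j)%N, (j < k)%N,
        holds R1 (e i) (e j), holds R2 (e j) (e k) & holds R3 (e i) (e k)]].

Definition avoiders (R1 R2 R3 : relsym) : {set {ffun 'I_n -> 'I_n}} :=
  [set e | inversion_seq e && ~~ contains R1 R2 R3 e].

Definition dist e : nat := #|[set e i | i : 'I_n]|.

End InversionSequences.

(** * Generating functions *)

(* The fraction field of Q[t][[z]], in which all the closed forms live; the
   polynomial variable 'X plays the role of t. *)
Definition genfun := {fraction (fps {poly rat})}.

Definition gf_z : genfun := (fpsX {poly rat})%:F.
Definition gf_t : genfun := (fpsC ('X : {poly rat}))%:F.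

(* The element of Q[t][[z]] whose coefficient of z^n is the distribution of
   dist over the avoiders of length n. *)
Definition gf_avoid (R1 R2 R3 : relsym) : genfun :=
  (Fps (fun n => \sum_(e in avoiders n R1 R2 R3) 'X^(dist e) : {poly rat}))%:F.

(* Main.v *)
Require Import Defs.
From mathcomp Require Import all_boot all_order all_algebra.
From mathcomp Require Import ring zify.
From mathcomp Require boolp.

(* An inversion sequence is grown one entry at a time. The generating function
   G(p) of the continuations of a prefix p satisfies
     G(p) = 1 + z * sum_v w(v) G(p v)
   over the entries v that complete no occurrence of the pattern, with w(v) = t
   if v is new and 1 otherwise. Power series solutions of this system are
   unique, so it suffices to exhibit them. In each of the ten classes an
   avoider is a prefix of a simple shape (zeros, or 0 1 2 ..., or weakly
   increasing) followed by a constant or decreasing tail. Decreasing tails below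
   m contribute prod_(u < m) (1 + g w(u)), where g is z/(1-z) (weak) or z
   (strict). Over a weakly increasing prefix of length n and maximum M the
   solution is a combination of powers r^(n-M), where r is the power series root
   of z r^2 - (1 + z - z t) r + (1 + g t) = 0 (with g = 0 for constant tails);
   this is the origin of the square roots. *)

Set Implicit Arguments.
Unset Strict Implicit.
Unset Printing Implicit Defensive.

Import GRing.Theory.
Local Open Scope ring_scope.

(** * Power series inside the fraction field *)

Section PowerSeries.
Variable R : idomainType.
Implicit Types f g : fps R.
Local Notation K := {fraction (fps R)}.
Local Notation z := ((fpsX R)%:F : K).
Implicit Types x y : K.

Lemma coefs_sum (I : Type) (r : seq I) (P : pred I) (F : I -> fps R) n :
  coefs (\sum_(i <- r | P i) F i) n = \sum_(i <- r | P i) coefs (F i) n.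
Proof. exact: (big_morph (fun f => coefs f n) (fun f g => coefsD f g n)). Qed.

Lemma coefsXM f n :
  coefs (fpsX R * f) n = if n is m.+1 then coefs f m else 0.
Proof.
rewrite coefsM; case: n => [|n].
  by rewrite big_ord_recl big_ord0 mul0r addr0.
rewrite big_ord_recl mul0r add0r big_ord_recl /= mul1r subSS subn0.
by rewrite big1 ?addr0 // => i _; rewrite mul0r.
Qed.

Lemma coefsXnM m f n : (n < m)%N -> coefs (fpsX R ^+ m * f) n = 0.
Proof.
elim: m n => // m IHm [|n] lt_nm; rewrite exprS -mulrA coefsXM //.
exact: IHm.
Qed.

Lemma fpsX_dvd f : coefs f 0 = 0 -> exists g, f = fpsX R * g.
Proof.
move=> f0; exists (Fps (fun n => coefs f n.+1)).
by apply/fpsP=> -[|n]; rewrite coefsXM.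
Qed.

(** The inverse is the geometric series in [u := fpsX R * f]. Its coefficient [n] is read off the
    partial sum with [n + 1] terms, since no later power of [u] has a term of degree [n]. *)
Lemma fps_geometric f : exists g, g * (1 - fpsX R * f) = 1.
Proof.
pose u := fpsX R * f; pose S n := \sum_(i < n) u ^+ i.
have SE n m : (n < m)%N -> coefs (S m) n = coefs (S n.+1) n.
  elim: m => // m IHm; rewrite ltnS leq_eqVlt => /orP[/eqP-> //|lt_nm].
  by rewrite /S big_ord_recr coefsD -/(S m) IHm //= exprMn coefsXnM ?addr0.
exists (Fps (fun n => coefs (S n.+1) n)); apply/fpsP=> n.
transitivity (coefs (S n.+1 * (1 - u)) n).
  rewrite !coefsM; apply: eq_bigr => i _; congr (_ * _).
  by rewrite /= [RHS]SE.
have -> : S n.+1 * (1 - u) = 1 - u ^+ n.+1.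
  rewrite -[in RHS](expr1n _ n.+1) subrXX mulrC; congr (_ * _).
  by apply: eq_bigr => i _; rewrite expr1n mul1r.
by rewrite coefsB exprMn coefsXnM ?subr0.
Qed.

(** The closed forms are fractions; this predicate records which of them are power series, as the
    coefficientwise uniqueness argument requires. *)
Definition is_ps x := exists f, x = f%:F.

Lemma is_ps_tofrac f : is_ps f%:F. Proof. by exists f. Qed.
Lemma is_ps0 : is_ps 0. Proof. by exists 0; rewrite tofrac0. Qed.
Lemma is_ps1 : is_ps 1. Proof. by exists 1; rewrite tofrac1. Qed.
Lemma is_psD x y : is_ps x -> is_ps y -> is_ps (x + y).
Proof. by move=> [f ->] [g ->]; exists (f + g); rewrite tofracD. Qed.
Lemma is_psN x : is_ps x -> is_ps (- x).
Proof. by move=> [f ->]; exists (- f); rewrite tofracN. Qed.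
Lemma is_psM x y : is_ps x -> is_ps y -> is_ps (x * y).
Proof. by move=> [f ->] [g ->]; exists (f * g); rewrite tofracM. Qed.
Lemma is_psX x n : is_ps x -> is_ps (x ^+ n).
Proof. by move=> [f ->]; exists (f ^+ n); rewrite tofracXn. Qed.
Lemma is_psMn x n : is_ps x -> is_ps (x *+ n).
Proof. by move=> [f ->]; exists (f *+ n); rewrite tofracMn. Qed.
Lemma is_ps_sum (I : Type) (r : seq I) (P : pred I) (F : I -> K) :
  (forall i, P i -> is_ps (F i)) -> is_ps (\sum_(i <- r | P i) F i).
Proof. by move=> psF; elim/big_ind: _ => //; [exact: is_ps0|exact: is_psD]. Qed.
Lemma is_ps_prod (I : Type) (r : seq I) (P : pred I) (F : I -> K) :
  (forall i, P i -> is_ps (F i)) -> is_ps (\prod_(i <- r | P i) F i).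
Proof. by move=> psF; elim/big_ind: _ => //; [exact: is_ps1|exact: is_psM]. Qed.

Lemma oneBz_neq0 x : is_ps x -> 1 - z * x != 0.
Proof.
move=> [f ->]; rewrite -tofracM -tofrac1 -tofracB tofrac_eq0.
apply/eqP=> /fpsP/(_ 0%N)/eqP.
by rewrite coefsB coefsXM coefs1 coefs0 subr0 oner_eq0.
Qed.

Lemma is_psV x : is_ps x -> is_ps (1 - z * x)^-1.
Proof.
move=> px; have nz := oneBz_neq0 px; case: px nz => f -> nz.
have [g gf1] := fps_geometric f; exists g.
by apply: (mulIf nz); rewrite mulVf // -tofracM -tofrac1 -tofracB -tofracM gf1.
Qed.

(** Divisibility of the difference by [z ^+ n.+1] equates the coefficients of index [n]. *)
Lemma is_ps_ext x y : is_ps x -> is_ps y ->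
  (forall n, exists2 d, is_ps d & x - y = z ^+ n * d) -> x = y.
Proof.
move=> [f ->] [g ->] dvd; apply/eqP; rewrite tofrac_eq; apply/eqP/fpsP=> n.
have [_ [h ->] /eqP] := dvd n.+1.
rewrite -tofracB -tofracXn -tofracM tofrac_eq => /eqP/fpsP/(_ n).
by rewrite coefsXnM // coefsB => /eqP; rewrite subr_eq0 => /eqP.
Qed.

End PowerSeries.

(** * Growing inversion sequences *)

Section Growth.
Variables R1 R2 R3 : relsym.
Implicit Types (past s : seq nat) (v w : nat).

(* The entries placed so far are listed latest first: [completes past v] says
   that appending v to them creates an occurrence of the pattern. *)
Fixpoint completes past v : bool :=
  if past is x :: p then
    has (fun y => holds R1 y x && holds R3 y v) p && holds R2 x v
    || completes p v
  else false.

Fixpoint admissible past s : bool :=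
  if s is v :: s' then
    [&& (v <= size past)%N, ~~ completes past v & admissible (v :: past) s']
  else true.

Fixpoint new_values past s : nat :=
  if s is v :: s' then ((v \notin past) + new_values (v :: past) s')%N else 0%N.

Fixpoint growth n past : {poly rat} :=
  if n is m.+1 then
    \sum_(v < (size past).+1 | ~~ completes past v)
       'X^(val v \notin past) * growth m (val v :: past)
  else 1.

(** Entries are drawn from a fixed ['I_N], so that the index type does not change along the
    induction; the bound on [N] ensures that it contains every value a continuation can take. *)
Lemma growth_tuples n past N : (size past + n <= N)%N ->
  \sum_(s : n.-tuple 'I_N | admissible past (map val s))
     'X^(new_values past (map val s)) = growth n past.
Proof.
elim: n past => [|n IHn] past leN.
  rewrite (eq_bigl (pred1 [tuple])) ?big_pred1_eq //= => s.
  by rewrite [s]tuple0 [RHS]eqxx.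
pose h (p : 'I_N * n.-tuple 'I_N) := [tuple of p.1 :: p.2].
pose h' (s : n.+1.-tuple 'I_N) := (thead s, [tuple of behead s]).
rewrite (reindex h) /=; last first.
  exists h' => [[x s] _|s _]; last by rewrite [RHS]tuple_eta.
  by congr pair; apply: val_inj.
under eq_bigl do rewrite andbA.
rewrite -(pair_big_dep
  (fun v : 'I_N => (v <= size past)%N && ~~ completes past v)
  (fun (v : 'I_N) (s : n.-tuple 'I_N) => admissible (val v :: past) (map val s))
  (fun (v : 'I_N) (s : n.-tuple 'I_N) =>
     'X^((val v \notin past) + new_values (val v :: past) (map val s)) :
       {poly rat})) /=.
have lt_N : ((size past).+1 <= N)%N by lia.
rewrite (big_ord_widen_cond _ (fun v => ~~ completes past v)
  (fun v => 'X^(v \notin past) * growth n (v :: past)) lt_N).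
apply: eq_big => [v|v _]; first by rewrite andbC ltnS.
rewrite -(IHn (val v :: past)) /=; last by lia.
by rewrite mulr_sumr; apply: eq_bigr => s _; rewrite exprD.
Qed.

(** [admissible] recurses on the first entry, but an occurrence of the pattern is detected at its
    last one; peeling from the right reconciles the two. *)
Lemma admissible_rcons past s v :
  admissible past (rcons s v) =
  [&& admissible past s, (v <= size past + size s)%N
    & ~~ completes (catrev s past) v].
Proof.
elim: s past => [|x s IHs] past /=; first by rewrite addn0 andbT.
by rewrite IHs /= addSnnS !andbA.
Qed.

Lemma completesP s v :
  reflect (exists i j, [/\ (i < j < size s)%N,
                           holds R1 (nth 0%N s i) (nth 0%N s j),
                           holds R2 (nth 0%N s j) v & holds R3 (nth 0%N s i) v])
          (completes (rev s) v).
Proof.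
elim/last_ind: s => [|s x IHs]; first by right=> -[i [j []]]; rewrite andbF.
rewrite rev_rcons /=; apply: (iffP orP) => [[/andP[]|/IHs]|].
- rewrite has_rev => /(has_nthP 0%N)[i lt_i /andP[r1 r3]] r2.
  exists i, (size s); rewrite size_rcons !nth_rcons lt_i ltnn eqxx ltnSn.
  by split.
- move=> [i [j [/andP[lt_ij lt_j] r1 r2 r3]]]; exists i, j.
  rewrite size_rcons !nth_rcons lt_j (ltn_trans lt_ij lt_j) lt_ij.
  by split=> //=; apply: leqW.
move=> [i [j []]]; rewrite size_rcons ltnS => /andP[lt_ij le_j].
rewrite !nth_rcons (leq_trans lt_ij le_j).
move: le_j; rewrite leq_eqVlt => /orP[/eqP ejs|lt_j].
  rewrite ejs ltnn eqxx => r1 r2 r3; left; rewrite r2 andbT has_rev.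
  by apply/(has_nthP 0%N); exists i; rewrite -?ejs // r1.
by rewrite lt_j => r1 r2 r3; right; apply/IHs; exists i, j; rewrite lt_ij.
Qed.

(** A triple [i < j < k] is tested exactly when entry [k] is appended, so induction from the right
    separates the triples ending at the final position. *)
Lemma admissibleP s :
  reflect ((forall k, (k < size s)%N -> ((nth 0%N s k) <= k)%N) /\
           (forall i j k, (i < j)%N -> (j < k)%N -> (k < size s)%N ->
              ~~ [&& holds R1 (nth 0%N s i) (nth 0%N s j),
                     holds R2 (nth 0%N s j) (nth 0%N s k)
                   & holds R3 (nth 0%N s i) (nth 0%N s k)]))
          (admissible [::] s).
Proof.
elim/last_ind: s => [|s x IHs]; first by left.
rewrite admissible_rcons -/(rev s) add0n size_rcons.
apply: (iffP and3P) => [[/IHs[inv av] le_x /completesP ncx]|[inv av]].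
  split=> [k|i j k lt_ij lt_jk]; rewrite ltnS leq_eqVlt.
    case/orP=> [/eqP->|lt_k]; rewrite nth_rcons ?ltnn ?eqxx // lt_k.
    exact: inv.
  case/orP=> [/eqP ek|lt_k].
    have lt_i : (i < size s)%N by lia.
    have lt_j : (j < size s)%N by lia.
    rewrite !nth_rcons lt_i lt_j ek ltnn eqxx; apply/and3P => -[r1 r2 r3].
    by apply: ncx; exists i, j; rewrite lt_ij lt_j.
  have lt_i : (i < size s)%N by lia.
  have lt_j : (j < size s)%N by lia.
  by rewrite !nth_rcons lt_i lt_j lt_k; apply: av.
split.
- apply/IHs; split=> [k lt_k|i j k lt_ij lt_jk lt_k].
    by have := inv k (leqW lt_k); rewrite nth_rcons lt_k.
  have lt_i : (i < size s)%N by lia.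
  have lt_j : (j < size s)%N by lia.
  have := av i j k lt_ij lt_jk (leqW lt_k).
  by rewrite !nth_rcons lt_i lt_j lt_k.
- by have := inv (size s) (ltnSn _); rewrite nth_rcons ltnn eqxx.
apply/completesP=> -[i [j [/andP[lt_ij lt_j] r1 r2 r3]]].
have := av i j (size s) lt_ij lt_j (ltnSn _).
by rewrite !nth_rcons (ltn_trans lt_ij lt_j) lt_j ltnn eqxx r1 r2 r3.
Qed.

(** From the empty past, this identifies [new_values] with the number of distinct entries. *)
Lemma new_values_undup past s :
  (size (undup past) + new_values past s = size (undup (catrev s past)))%N.
Proof.
elim: s past => [|v s IHs] past /=; first by rewrite addn0.
by rewrite -IHs /= addnA; case: (v \in past); rewrite /= ?addn0 ?addn1.
Qed.

Lemma sum_avoidersE n :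
  \sum_(e in avoiders n R1 R2 R3) 'X^(dist e) = growth n [::].
Proof.
pose l (e : {ffun 'I_n -> 'I_n}) : seq nat := map val (tuple_of_finfun e).
have size_l e : size (l e) = n by rewrite size_map size_tuple.
have nth_l e (i : 'I_n) : nth 0%N (l e) i = e i.
  rewrite (nth_map (e i)) ?size_tuple // -tnth_nth.
  by rewrite -[in RHS](tuple_of_finfunK e) ffunE.
rewrite -(@growth_tuples n [::] n) //.
rewrite (reindex (@tuple_of_finfun 'I_n n)) /=; last first.
  by exists (@finfun_of_tuple 'I_n n) => x _;
    rewrite ?tuple_of_finfunK ?finfun_of_tupleK.
apply: eq_big => [e|e _]; rewrite -/(l e).
  rewrite inE; apply/andP/admissibleP => [[/forallP inv /negP av]|[inv av]].
    split=> [k|i j k lt_ij lt_jk]; rewrite size_l => lt_k.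
      by rewrite (nth_l e (Ordinal lt_k)); exact: (inv (Ordinal lt_k)).
    have lt_j := ltn_trans lt_jk lt_k; have lt_i := ltn_trans lt_ij lt_j.
    apply/negP=> pat; apply: av.
    apply/existsP; exists (Ordinal lt_i); apply/existsP; exists (Ordinal lt_j).
    apply/existsP; exists (Ordinal lt_k); rewrite lt_ij lt_jk /=.
    by rewrite -!nth_l.
  split; first by apply/forallP=> i; rewrite -nth_l; apply: inv; rewrite size_l.
  apply/negP=> /existsP[i /existsP[j /existsP[k /and5P[lt_ij lt_jk r1 r2 r3]]]].
  have := av i j k lt_ij lt_jk; rewrite size_l !nth_l => /(_ (ltn_ord k)).
  by rewrite r1 r2 r3.
have := new_values_undup [::] (l e); rewrite /= add0n => ->.
congr 'X^_; rewrite /dist cardE -(size_map val); apply/eqP.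
rewrite -uniq_size_uniq ?undup_uniq ?(map_inj_uniq val_inj) ?enum_uniq //.
move=> v; rewrite mem_undup -/(rev _) mem_rev; apply/idP/mapP.
  case/(nthP 0%N)=> i; rewrite size_l => lt_i <-.
  exists (e (Ordinal lt_i)); last exact: (nth_l e (Ordinal lt_i)).
  by rewrite mem_enum imset_f.
move=> [x]; rewrite mem_enum => /imsetP[i _ ->] ->.
by rewrite -[val _](nth_l e i) mem_nth ?size_l.
Qed.

End Growth.

(** * Generating functions of continuations *)

Section GeneratingFunctions.
Local Notation z := gf_z.
Local Notation t := gf_t.

Lemma is_ps_z : is_ps z. Proof. exact: is_ps_tofrac. Qed.
Lemma is_ps_t : is_ps t. Proof. exact: is_ps_tofrac. Qed.

Lemma z_neq0 : z != 0.
Proof.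
rewrite tofrac_eq0; apply/eqP=> /fpsP/(_ 1%N)/eqP.
by rewrite coefs0 oner_eq0.
Qed.

Lemma oneB_z_neq0 : 1 - z != 0.
Proof. by have := oneBz_neq0 (is_ps1 {poly rat}); rewrite mulr1. Qed.

Lemma is_psV_oneB_z : is_ps (1 - z)^-1.
Proof. by have := is_psV (is_ps1 {poly rat}); rewrite mulr1. Qed.

Definition weight (past : seq nat) (v : nat) : genfun :=
  if v \in past then 1 else t.

Lemma is_ps_weight past v : is_ps (weight past v).
Proof. by rewrite /weight; case: ifP => _; [exact: is_ps1|exact: is_ps_t]. Qed.

Lemma weight_in past v : v \in past -> weight past v = 1.
Proof. by rewrite /weight => ->. Qed.

Lemma weight_notin past v : v \notin past -> weight past v = t.
Proof. by rewrite /weight => /negPf->. Qed.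

Lemma weight_cons past v u : u != v -> weight (v :: past) u = weight past u.
Proof. by rewrite /weight inE => /negPf->. Qed.

Lemma geometric_fix (K : fieldType) (x : K) :
  1 - x != 0 -> (1 - x)^-1 = 1 + x * (1 - x)^-1.
Proof. by move=> nz; field. Qed.

Lemma mulr4_ac (K : comPzRingType) (a b c d : K) :
  a * (b * (c * d)) = a * d * b * c.
Proof. by rewrite mulrCA !mulrA mulrAC [b * a]mulrC [_ * b * d]mulrAC. Qed.

(** The summand at [v] is the increment of the product when the factor [1 + c v] joins it. *)
Lemma sum_prod_telescope (K : comPzRingType) (c : nat -> K) m :
  1 + \sum_(0 <= v < m) c v * \prod_(0 <= u < v) (1 + c u)
    = \prod_(0 <= u < m) (1 + c u).
Proof.
elim: m => [|m IHm]; first by rewrite !big_geq ?addr0.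
by rewrite !big_nat_recr //= addrA IHm mulrDr mulr1 [c m * _]mulrC.
Qed.

Section Completions.
Variables R1 R2 R3 : relsym.
Implicit Types (past : seq nat) (v w : nat) (x : genfun).
Local Notation completes := (completes R1 R2 R3).

Definition gf_from past : genfun :=
  (Fps (fun n => growth R1 R2 R3 n past))%:F.

Lemma gf_avoidE : gf_avoid R1 R2 R3 = gf_from [::].
Proof.
by congr (FracField.tofrac _); apply/fpsP=> n; apply: sum_avoidersE.
Qed.

Lemma gf_fromE past :
  gf_from past =
    1 + z * \sum_(0 <= v < (size past).+1 | ~~ completes past v)
              weight past v * gf_from (v :: past).
Proof.
pose W v : fps {poly rat} := if v \in past then 1 else fpsC 'X.
pose f p := Fps (fun n => growth R1 R2 R3 n p).
have WE v : weight past v = (W v)%:F.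
  by rewrite /weight /W; case: ifP; rewrite // tofrac1.
under eq_bigr do rewrite WE -tofracM.
rewrite -rmorph_sum /gf_z -tofracM -tofrac1 -tofracD.
congr (FracField.tofrac _); apply/fpsP=> n.
rewrite coefsD coefsXM coefs1; case: n => [|n]; first by rewrite addr0.
rewrite add0r coefs_sum big_mkord /=; apply: eq_bigr => v _.
rewrite /W; case: ifP => _ /=;
  by rewrite big_ord_recl /= subn0 big1 ?addr0 ?mul1r // => i _; rewrite mul0r.
Qed.

(* In [gf_fromE], an error divisible by z^n on the right is divisible by
   z^(n+1) on the left, so a closed form for gf_from only has to be checked
   against that equation; [St past x] reads: x is the claim for past. *)
Lemma gf_from_unique (St : seq nat -> genfun -> Prop) :
  (forall past x, St past x -> is_ps x /\
     exists y : nat -> genfun,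
       (forall v, (v <= size past)%N -> ~~ completes past v ->
          St (v :: past) (y v) \/ y v = gf_from (v :: past)) /\
       x = 1 + z * \sum_(0 <= v < (size past).+1 | ~~ completes past v)
                     weight past v * y v) ->
  forall past x, St past x -> gf_from past = x.
Proof.
move=> stP past x stx; apply/esym.
apply: is_ps_ext; [by case: (stP _ _ stx)|exact: is_ps_tofrac|].
move=> n; elim: n past x stx => [|n IHn] past x stx.
  exists (x - gf_from past); last by rewrite mul1r.
  apply: is_psD; first by case: (stP _ _ stx).
  exact/is_psN/is_ps_tofrac.
have [_ [y [y_st ->]]] := stP _ _ stx.
have dvd v : (v <= size past)%N && ~~ completes past v ->
    exists2 d, is_ps d & y v - gf_from (v :: past) = z ^+ n * d.
  (* A child given by [gf_from] itself carries no error. *)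
  case/andP=> le_v nc; have [/IHn //|->] := y_st v le_v nc.
  by exists 0; rewrite ?subrr ?mulr0 //; apply: is_ps0.
have [d dP] : exists d : nat -> genfun,
    forall v, (v <= size past)%N && ~~ completes past v ->
      is_ps (d v) /\ y v - gf_from (v :: past) = z ^+ n * d v.
  have : forall v, exists d,
      (v <= size past)%N && ~~ completes past v ->
        is_ps d /\ y v - gf_from (v :: past) = z ^+ n * d.
    move=> v; case: (boolP (_ && _)) => [/dvd[d psd e]|_]; last by exists 0.
    by exists d.
  by move/boolp.choice=> [f fP]; exists f.
exists (\sum_(0 <= v < (size past).+1 | ~~ completes past v)
          weight past v * d v).
  rewrite big_nat_cond; apply: is_ps_sum => v /andP[/andP[_ le_v] nc].
  apply: is_psM; first exact: is_ps_weight.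
  by apply: (dP v _).1; rewrite nc andbT -ltnS.
rewrite [in LHS]gf_fromE opprD addrACA subrr add0r -mulrBr -sumrB exprS -mulrA.
congr (_ * _); rewrite mulr_sumr big_nat_cond [RHS]big_nat_cond.
apply: eq_bigr => v /andP[/andP[_ le_v] nc].
by rewrite -mulrBr (dP v _).2 1?mulrCA // nc andbT -ltnS.
Qed.

Lemma big_completes_lt past m (F : nat -> genfun) :
  (m <= (size past).+1)%N -> (forall w, completes past w = (m <= w)%N) ->
  \sum_(0 <= v < (size past).+1 | ~~ completes past v) F v
    = \sum_(0 <= v < m) F v.
Proof.
move=> le_m cE; rewrite [RHS](big_nat_widen _ _ _ _ _ le_m) /=.
by apply: eq_bigl => v; rewrite cE -ltnNge.
Qed.

(** Only [c] may follow, and the last hypothesis keeps it allowed afterwards: there is one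
    continuation of each length, and it brings no new value. *)
Lemma gf_const past c :
    (forall w, completes past w = (w != c)) -> c \in past ->
    (c <= size past)%N ->
    (forall y, ~~ [&& holds R1 y c, holds R3 y c & holds R2 c c]) ->
  gf_from past = (1 - z)^-1.
Proof.
move=> cE c_in le_c nR.
have nz := oneB_z_neq0.
apply: (@gf_from_unique (fun past x =>
  [/\ forall w, completes past w = (w != c),
  c \in past, (c <= size past)%N & x = (1 - z)^-1])); last by [].
move=> {cE c_in le_c} p x [cE c_in le_c ->]; split; first exact: is_psV_oneB_z.
exists (fun=> (1 - z)^-1); split=> [v _|].
  rewrite cE negbK => /eqP->; left; split; rewrite ?inE ?eqxx //=; last lia.
  move=> w; rewrite cE; case: eqVneq => [->|_]; last by rewrite orbT.
  rewrite orbF; apply/negP=> /andP[/hasP[y _ /andP[r1 r3]] r2].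
  by have := nR y; rewrite r1 r3 r2.
under eq_bigl do rewrite cE negbK.
rewrite big_nat1_eq /= ltnS le_c weight_in // mul1r.
exact: geometric_fix.
Qed.

(** * Decreasing tails *)

Section Tail.
Variables (d : bool) (g : genfun).
Hypothesis R2E : forall v w, holds R2 v w = (v + d <= w)%N.
Hypothesis ps_g : is_ps g.
Hypothesis g_eq : z * (1 + g) ^+ d = g.

(** The value [v] just placed has weight 1 in the new past. For [d = true] its factor [1 + g] is
    still present and [z * (1 + g) = g]; for [d = false] it is absent and [z = g]. Either way the
    sum telescopes. *)
Lemma tail_sum past m :
  1 + z * \sum_(0 <= v < m)
        weight past v * \prod_(0 <= u < v + d) (1 + g * weight (v :: past) u)
    = \prod_(0 <= u < m) (1 + g * weight past u).
Proof.
rewrite -sum_prod_telescope mulr_sumr; congr (1 + _); apply: eq_bigr => v _.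
have eP : \prod_(0 <= u < v) (1 + g * weight (v :: past) u)
          = \prod_(0 <= u < v) (1 + g * weight past u).
  by apply: eq_big_nat => u /andP[_ lt_u]; rewrite weight_cons // neq_ltn lt_u.
rewrite -[X in X * weight past v * _]g_eq; case: (d); rewrite ?addn1 ?addn0 /=.
  rewrite big_nat_recr //= eP (weight_in (mem_head v past)) mulr1 expr1.
  exact: mulr4_ac.
by rewrite eP expr0 mulr1 mulrA.
Qed.

(* From such a past on, the continuations are exactly the decreasing sequences
   with entries below m: weakly decreasing if d, strictly otherwise. *)
Definition tail_state past m : Prop :=
  [/\ (m <= (size past).+1)%N,
      forall w, completes past w = (m <= w)%N &
      forall v w, (v < m)%N -> (w < m)%N -> (v + d <= w)%N ->
        has (fun y => holds R1 y v && holds R3 y w) past].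

(** A decreasing tail decides independently for each [u < m] whether [u] occurs; if so, its copies
    form a block, enumerated by [g * weight past u]. *)
Lemma gf_tail past m : tail_state past m ->
  gf_from past = \prod_(0 <= u < m) (1 + g * weight past u).
Proof.
move=> st; apply: (@gf_from_unique (fun past x => exists2 m, tail_state past m
  & x = \prod_(0 <= u < m) (1 + g * weight past u))); last by exists m.
move=> {st m} p x [m [le_m cE hasE] ->]; split.
  apply: is_ps_prod => u _; apply: is_psD; first exact: is_ps1.
  by apply: is_psM => //; apply: is_ps_weight.
exists (fun v => \prod_(0 <= u < v + d) (1 + g * weight (v :: p) u)).
split=> [v le_v|]; last by rewrite (big_completes_lt _ le_m cE) tail_sum.
rewrite cE -ltnNge => lt_v; left; exists (v + d)%N => //; split=> /=.
- by case: (d); lia.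
- move=> w; rewrite R2E cE; case: (leqP m w) => [le_mw|lt_wm].
    by rewrite orbT; apply/esym; case: (d); lia.
  (* A value [w < m] with [v + d <= w] becomes forbidden: the third clause of the state supplies the
     first entry of an occurrence. *)
  rewrite orbF; case: (leqP (v + d) w) => [le_vw|]; last by rewrite andbF.
  by rewrite hasE.
move=> v' w lt_v' lt_w le_w; rewrite hasE ?orbT //; move: lt_v' lt_w.
  by case: (d); lia.
by case: (d); lia.
Qed.

End Tail.

End Completions.

Lemma distr3 (K : pzRingType) (x a b c : K) :
  1 + x * (a + (b + c)) = 1 + x * a + x * b + x * c.
Proof. by rewrite !mulrDr !addrA. Qed.

(** * Functional equations for the three kinds of prefixes *)

Section Prefixes.
Variables R1 R2 R3 : relsym.
Implicit Types (past : seq nat) (v w k : nat) (x : genfun).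
Local Notation completes := (completes R1 R2 R3).
Local Notation gf_from := (gf_from R1 R2 R3).
Local Notation gf_avoid := (gf_avoid R1 R2 R3).

Lemma big_all_free past (F : nat -> genfun) :
  (forall w, completes past w = false) ->
  \sum_(0 <= v < (size past).+1 | ~~ completes past v) F v
    = \sum_(0 <= v < (size past).+1) F v.
Proof. by move=> cE; apply: eq_bigl => v; rewrite cE. Qed.

(* After the increasing prefix 0 1 ... k-1. *)
Definition iota_state past k : Prop :=
  [/\ size past = k, forall w, (w \in past) = (w < k)%N &
      forall w, completes past w = false].

(** After [0 1 ... k-1] the next entry is an old value, with total contribution [T k], or the new
    value [k], which extends the prefix. No pair of the prefix satisfies [R1], so nothing is
    forbidden yet. *)
Lemma gf_iota (Phi T : nat -> genfun) :
    (forall v w, (v < w)%N -> ~~ holds R1 v w) ->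
    (forall k, is_ps (Phi k)) ->
    (forall past k, iota_state past k ->
       z * \sum_(0 <= v < k) gf_from (v :: past) = T k) ->
    (forall k, Phi k = 1 + T k + z * t * Phi k.+1) ->
  gf_avoid = Phi 0%N.
Proof.
move=> nR1 psPhi TE PhiE; rewrite gf_avoidE.
apply: (@gf_from_unique _ _ _ (fun past x =>
  exists2 k, iota_state past k & x = Phi k)); last by exists 0%N.
move=> past x [k st ->]; split=> //.
have [size_past mem_past cE] := st.
(* Children that leave the prefix are passed as [gf_from] itself; [TE] evaluates their sum. *)
exists (fun v => if (v < k)%N then gf_from (v :: past) else Phi k.+1).
split=> [v|].
  rewrite size_past leq_eqVlt cE => /orP[/eqP-> _|->]; last by right.
  rewrite ltnn; left; exists k.+1 => //; split=> [|w|w] /=.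
  - by rewrite size_past.
  - by rewrite inE mem_past ltnS [RHS]leq_eqVlt.
  rewrite cE orbF; apply/negP=> /andP[/hasP[y]].
  by rewrite mem_past => /nR1/negPf->.
rewrite big_all_free // size_past big_nat_recr //= ltnn.
rewrite weight_notin ?mem_past ?ltnn // mulrDr PhiE -(TE _ _ st) -addrA mulrA.
congr (_ + (z * _ + _)); apply: eq_big_nat => v /andP[_ lt_v].
by rewrite lt_v weight_in ?mem_past // mul1r.
Qed.

(* After the constant prefix 0 ... 0. *)
Lemma completes_nseq k w :
  ~~ holds R1 0%N 0%N -> completes (nseq k 0%N) w = false.
Proof.
move=> nR1; elim: k => //= k ->; rewrite orbF.
apply/negP=> /andP[/hasP[y]]; rewrite mem_nseq => /andP[_ /eqP->].
by rewrite (negPf nR1).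
Qed.

(** [Phi k] belongs to [k + 1] zeros; the first zero is forced and contributes [z * t]. [T k]
    collects the continuations whose next entry is nonzero, hence new. *)
Lemma gf_nseq (Phi T : nat -> genfun) :
    ~~ holds R1 0%N 0%N ->
    (forall k, is_ps (Phi k)) ->
    (forall k,
       z * \sum_(1 <= v < k.+2) t * gf_from (v :: nseq k.+1 0%N) = T k) ->
    (forall k, Phi k = 1 + T k + z * Phi k.+1) ->
  gf_avoid = 1 + z * t * Phi 0%N.
Proof.
move=> nR1 psPhi TE PhiE; rewrite gf_avoidE gf_fromE big_all_free //.
rewrite big_nat1 weight_notin // mulrA; congr (_ + _ * _).
apply: (@gf_from_unique _ _ _ (fun past x =>
  exists2 k, past = nseq k.+1 0%N & x = Phi k)); last by exists 0%N.
move=> _ _ [k -> ->]; split=> //.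
exists (fun v => if v is 0 then Phi k.+1 else gf_from (v :: nseq k.+1 0%N)).
split=> [[|v] _ _|]; [by left; exists k.+1|by right|].
rewrite big_all_free; last by move=> w; apply: completes_nseq.
rewrite size_nseq big_ltn // weight_in ?mem_nseq // mul1r mulrDr PhiE -TE.
rewrite -addrA; congr (1 + _); rewrite [LHS]addrC; congr (_ + z * _).
apply: eq_big_nat => -[|v] // _; rewrite weight_notin //.
by rewrite mem_nseq.
Qed.

(* After a weakly increasing prefix with maximum M. *)
Definition incr_state past (M : nat) : Prop :=
  [/\ M \in past, forall w, w \in past -> (w <= M)%N, (M < size past)%N &
      forall w, completes past w = false].

(** The terms stand for stopping, dropping below [M], repeating [M], and moving to a new maximum
    [i + M.+1], which is at most [size past]. *)
Lemma gf_incr (Phi : seq nat -> nat -> genfun) :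
    (forall v w, holds R1 v w = (w < v)%N) ->
    (forall past M, is_ps (Phi past M)) ->
    (forall past M, incr_state past M ->
       Phi past M = 1
         + z * \sum_(0 <= v < M) weight past v * gf_from (v :: past)
         + z * Phi (M :: past) M
         + z * t * \sum_(0 <= i < size past - M)
                      Phi (i + M.+1 :: past)%N (i + M.+1)%N) ->
  gf_avoid = 1 + z * t * Phi [:: 0%N] 0%N.
Proof.
move=> R1E psPhi PhiE; rewrite gf_avoidE gf_fromE big_all_free //.
rewrite big_nat1 weight_notin // mulrA; congr (_ + _ * _).
apply: (@gf_from_unique _ _ _ (fun past x =>
  exists2 M, incr_state past M & x = Phi past M)); last first.
  by exists 0%N => //; split=> // w; rewrite inE => /eqP->.
move=> past x [M st ->]; split=> //; have [M_in le_M lt_M cE] := st.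
exists (fun v => if (v < M)%N then gf_from (v :: past) else Phi (v :: past) v).
split=> [v le_v _|].
  case: ltnP => [_|le_Mv]; [by right|left; exists v => //; split=> /=].
  - exact: mem_head.
  - by move=> w; rewrite inE => /predU1P[->//|/le_M/leq_trans->].
  - by rewrite ltnS.
  move=> w; rewrite cE orbF; apply/negP=> /andP[/hasP[y /le_M le_y]].
  by rewrite R1E ltnNge (leq_trans le_y le_Mv).
rewrite big_all_free // (big_cat_nat (n := M)) /= ?(ltnW lt_M) //; last first.
  exact: leqW (ltnW lt_M).
rewrite [\sum_(M <= v < _) _]big_ltn ?ltnS ?(ltnW lt_M) // ltnn.
rewrite weight_in // mul1r.
rewrite PhiE // [RHS]distr3 -mulrA; congr (_ + _ * _ + _ + _ * _).
  by apply: eq_big_nat => v /andP[_ ->].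
rewrite -[X in index_iota X (size past).+1]add0n big_addn subSS.
rewrite mulr_sumr; apply: eq_big_nat => i _.
rewrite ltnNge addnS (leqW (leq_addl i M)) /= weight_notin //.
by apply/negP=> /le_M; lia.
Qed.

Section Tail.
Variables (d : bool) (g : genfun).
Hypothesis R2E : forall v w, holds R2 v w = (v + d <= w)%N.
Hypothesis ps_g : is_ps g.
Hypothesis g_eq : z * (1 + g) ^+ d = g.

(** Two instances of [tail_sum], at [m2] and at [m1], are subtracted. *)
Lemma gf_tails past m1 m2 : (m1 <= m2)%N ->
    (forall v, (m1 <= v < m2)%N -> tail_state R1 R2 R3 d (v :: past) (v + d)) ->
  z * \sum_(m1 <= v < m2) weight past v * gf_from (v :: past)
    = \prod_(0 <= u < m2) (1 + g * weight past u)
        - \prod_(0 <= u < m1) (1 + g * weight past u).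
Proof.
move=> le_m st; rewrite -!(tail_sum g_eq) opprD addrACA subrr add0r -mulrBr.
rewrite [X in X - _](big_cat_nat (leq0n m1) le_m) [X in X - _]addrC addrK.
congr (_ * _); apply: eq_big_nat => v lt_v.
by rewrite (gf_tail R2E ps_g g_eq (st v lt_v)).
Qed.

End Tail.

End Prefixes.

(** * Prefixes of zeros, and strictly increasing prefixes *)

Section SolvedRecurrences.
Variable K : fieldType.
Implicit Types x y g b : K.

(** Unrolling the recurrence gives a geometric series of ratio [x * (y * (1 + g))]. *)
Lemma iota_recurrence x y g k : 1 - x * (y * (1 + g)) != 0 ->
  (1 + g) ^+ k / (1 - x * (y * (1 + g)))
    = 1 + ((1 + g) ^+ k - 1)
        + x * y * ((1 + g) ^+ k.+1 / (1 - x * (y * (1 + g)))).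
Proof. by move=> nz; rewrite exprS; field. Qed.

Lemma nseq_recurrence x g b k : 1 - x != 0 -> 1 - x * b != 0 ->
  (1 + g) * b ^+ k.+1 / (1 - x * b) - g / (1 - x)
    = 1 + ((1 + g) * b ^+ k.+1 - (1 + g))
        + x * ((1 + g) * b ^+ k.+2 / (1 - x * b) - g / (1 - x)).
Proof. by move=> nz1 nz2; rewrite (exprS b k.+1); field; apply/andP. Qed.

(** The inhomogeneous term is affine in [k], hence so is the solution. *)
Lemma lt_lt_recurrence x y k : 1 - x != 0 ->
  (1 - x)^-1 + y * (k.+1%:R * x / (1 - x) ^+ 2 + x ^+ 2 / (1 - x) ^+ 3)
    = 1 + x * (y / (1 - x) *+ k.+1)
        + x * ((1 - x)^-1
               + y * (k.+2%:R * x / (1 - x) ^+ 2 + x ^+ 2 / (1 - x) ^+ 3)).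
Proof. by move=> nz; rewrite -mulr_natr -[k.+2%:R]natr1; field. Qed.

Lemma ge_ne_recurrence x y k : 1 - x != 0 -> 1 - x * y != 0 ->
  (1 + x ^+ 2 * y / ((1 - x) * (1 - x * y))) / (1 - x * y)
     + k%:R * (x / ((1 - x) * (1 - x * y)))
  = 1 + x * ((1 - x)^-1 *+ k)
     + x * y * ((1 + x ^+ 2 * y / ((1 - x) * (1 - x * y))) / (1 - x * y)
                 + k.+1%:R * (x / ((1 - x) * (1 - x * y)))).
Proof.
by move=> nz1 nz2; rewrite -mulr_natr -[k.+1%:R]natr1; field; apply/andP.
Qed.

Lemma ge_le_recurrence x y k : 1 - x != 0 -> 1 - x * (y * (1 + x)) != 0 ->
  (1 + x) ^+ k / ((1 - x) * (1 - x * (y * (1 + x))))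
  = 1 + (x * ((1 + x) ^+ k / (1 - x)) + ((1 + x) ^+ k - 1))
    + x * y * ((1 + x) ^+ k.+1 / ((1 - x) * (1 - x * (y * (1 + x))))).
Proof. by move=> nz1 nz2; rewrite exprS; field; apply/andP. Qed.

Lemma repeat_recurrence x k : 1 - x != 0 ->
  (1 + x) ^+ k / (1 - x)
    = 1 + ((1 + x) ^+ k - 1 + x * ((1 + x) ^+ k / (1 - x))).
Proof. by move=> nz; field. Qed.

End SolvedRecurrences.

Lemma prod_const_nat (K : comPzRingType) (a : K) m n :
  \prod_(m <= u < n) a = a ^+ (n - m).
Proof. by rewrite prodr_const_nat. Qed.

Section TailClasses.
Variables (R2 : relsym) (d : bool) (g : genfun).
Hypothesis R2E : forall v w, holds R2 v w = (v + d <= w)%N.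
Hypothesis ps_g : is_ps g.
Hypothesis g_eq : z * (1 + g) ^+ d = g.

Lemma is_ps_1Dg : is_ps (1 + g). Proof. exact: is_psD (is_ps1 _) ps_g. Qed.
Lemma is_ps_1Dgt : is_ps (1 + g * t).
Proof. exact: is_psD (is_ps1 _) (is_psM ps_g is_ps_t). Qed.

(** Repeating a value [v] of the prefix creates an equal pair, which forbids every later [w] with
    [R2 v w]. The tail uses only old values, so each factor is [1 + g]. *)
Lemma gf_eq_any : gf_avoid Req R2 Rany = (1 - z * (t * (1 + g)))^-1.
Proof.
have ps_q : is_ps (t * (1 + g)) := is_psM is_ps_t is_ps_1Dg.
rewrite -[RHS]mul1r -(expr0 (1 + g)).
apply: (gf_iota (Phi := fun k => (1 + g) ^+ k / (1 - z * (t * (1 + g))))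
                (T := fun k => (1 + g) ^+ k - 1)).
- by move=> v w lt_vw /=; rewrite neq_ltn lt_vw.
- by move=> k; apply: is_psM (is_psV ps_q); apply: is_psX is_ps_1Dg.
- move=> past k [size_past mem_past cE].
  have -> : \sum_(0 <= v < k) gf_from Req R2 Rany (v :: past)
      = \sum_(0 <= v < k) weight past v * gf_from Req R2 Rany (v :: past).
    by apply: eq_big_nat => v /andP[_ lt_v]; rewrite weight_in ?mul1r ?mem_past.
  rewrite (gf_tails R2E ps_g g_eq) ?[X in _ - X]big_geq //.
    congr (_ - _); rewrite -{2}[k]subn0 -prod_const_nat.
    by apply: eq_big_nat => v /andP[_ lt_v]; rewrite weight_in ?mulr1 ?mem_past.
  move=> v /andP[_ lt_v]; split=> [|w|v' w lt_v' lt_w le_w] /=.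
  - by rewrite size_past; case: (d); lia.
  - rewrite cE orbF R2E; case: hasP => // -[]; exists v; rewrite ?mem_past //.
    by rewrite eqxx.
  rewrite andbT; case: (eqVneq v v') => //= neq_v.
  apply/hasP; exists v'; rewrite ?eqxx // mem_past.
  by move: lt_v' neq_v; case: (d); lia.
by move=> k; apply: iota_recurrence; apply: oneBz_neq0 ps_q.
Qed.

(** The first nonzero entry [v] differs from the zeros before it, which forbids every later [w] with
    [R2 v w]. In the tail product the old value 0 gives [1 + g], all others [1 + g * t]. *)
Lemma gf_ne_any : gf_avoid Rne R2 Rany =
  1 + z * t * ((1 + g) * (1 + g * t) / (1 - z * (1 + g * t)) - g / (1 - z)).
Proof.
rewrite -[1 + g * t in X in X / _]expr1.
apply: (gf_nseq
  (Phi := fun k => (1 + g) * (1 + g * t) ^+ k.+1 / (1 - z * (1 + g * t))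
                     - g / (1 - z))
  (T := fun k => (1 + g) * (1 + g * t) ^+ k.+1 - (1 + g))); first by [].
- move=> k; apply: is_psD.
    apply: is_psM (is_psV is_ps_1Dgt); apply: is_psM is_ps_1Dg _.
    exact: is_psX is_ps_1Dgt.
  exact/is_psN/(is_psM ps_g)/is_psV_oneB_z.
- move=> k; set past := nseq k.+1 0%N.
  have -> : \sum_(1 <= v < k.+2) t * gf_from Rne R2 Rany (v :: past)
    = \sum_(1 <= v < k.+2) weight past v * gf_from Rne R2 Rany (v :: past).
    apply: eq_big_nat => -[|v] // _; rewrite weight_notin //.
    by rewrite mem_nseq.
  have w0 : weight past 0 = 1 by rewrite weight_in // mem_nseq.
  rewrite (gf_tails R2E ps_g g_eq) //.
    rewrite big_ltn // big_nat1 w0 mulr1; congr (_ * _ - _).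
    transitivity (\prod_(1 <= v < k.+2) (1 + g * t)).
      apply: eq_big_nat => -[|v] // _.
      by rewrite weight_notin // mem_nseq.
    by rewrite prod_const_nat subn1.
  move=> -[|v] // lt_v; split=> [|w|v' w lt_v' lt_w le_w] /=.
  - by rewrite size_nseq; case: (d); lia.
  - have /= -> := @completes_nseq Rne R2 Rany k.+1 w isT.
    by rewrite orbF R2E.
  (* A zero [v'] is preceded by the nonzero entry [v.+1], a positive one by a zero. *)
  by case: v' {lt_v' lt_w le_w} => [|v'] //=; apply/orP; right.
move=> k; apply: nseq_recurrence; first exact: oneB_z_neq0.
exact: oneBz_neq0 is_ps_1Dgt.
Qed.

End TailClasses.

Lemma is_ps_natM n (x : genfun) : is_ps x -> is_ps (n%:R * x).
Proof. by move=> psx; rewrite mulr_natl; apply: is_psMn. Qed.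

(** After a zero and a positive entry, any further positive entry completes the pattern, so only
    zeros follow. *)
Lemma gf_lt_any_lt : gf_avoid Rlt Rany Rlt =
  1 + z * t * ((1 - z)^-1 + t * (1%:R * z / (1 - z) ^+ 2
                                  + z ^+ 2 / (1 - z) ^+ 3)).
Proof.
apply: (gf_nseq (Phi := fun k => (1 - z)^-1
    + t * (k.+1%:R * z / (1 - z) ^+ 2 + z ^+ 2 / (1 - z) ^+ 3))
  (T := fun k => z * (t / (1 - z) *+ k.+1))); first by [].
- move=> k; apply: is_psD is_psV_oneB_z _; apply: is_psM is_ps_t _.
  apply: is_psD; rewrite -exprVn; apply: is_psM;
    try exact: is_psX is_psV_oneB_z.
    exact: is_ps_natM is_ps_z.
  exact: is_psX is_ps_z.
- move=> k; congr (_ * _).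
  transitivity (\sum_(1 <= v < k.+2) t / (1 - z)); last first.
    by rewrite sumr_const_nat subn1.
  apply: eq_big_nat => -[|v] // _; congr (_ * _); apply: (gf_const (c := 0%N)).
  + move=> w; rewrite -[LHS]/(has (fun y => (y < v.+1)%N && (y < w)%N)
      (nseq k.+1 0%N) && true || completes Rlt Rany Rlt (nseq k.+1 0%N) w).
    by rewrite completes_nseq // orbF andbT has_nseq /= lt0n.
  + by rewrite inE mem_head orbT.
  + by [].
  by case.
by move=> k; apply: lt_lt_recurrence; apply: oneB_z_neq0.
Qed.

(** An entry [v < k] after [0 1 ... k-1] repeats a value, and this pair forbids every later entry
    other than [v]. The solution is affine in [k]; [0%:R] comes from evaluating it at [k = 0]. *)
Lemma gf_ge_ne_any : gf_avoid Rge Rne Rany =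
  (1 + z ^+ 2 * t / ((1 - z) * (1 - z * t))) / (1 - z * t)
    + 0%:R * (z / ((1 - z) * (1 - z * t))).
Proof.
have psV : is_ps ((1 - z) * (1 - z * t))^-1.
  by rewrite invfM; apply: is_psM is_psV_oneB_z (is_psV is_ps_t).
apply: (gf_iota (Phi := fun k =>
    (1 + z ^+ 2 * t / ((1 - z) * (1 - z * t))) / (1 - z * t)
      + k%:R * (z / ((1 - z) * (1 - z * t))))
  (T := fun k => z * ((1 - z)^-1 *+ k))).
- by move=> v w lt_vw /=; rewrite -ltnNge.
- move=> k; apply: is_psD; last first.
    by apply: is_ps_natM; apply: is_psM is_ps_z psV.
  apply: is_psM (is_psV is_ps_t); apply: is_psD (is_ps1 _) _.
  by apply: is_psM psV; apply: is_psM is_ps_t; apply: is_psX is_ps_z.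
- move=> past k [size_past mem_past cE]; congr (_ * _).
  rewrite -{2}[k]subn0 -sumr_const_nat; apply: eq_big_nat => v /andP[_ lt_v].
  apply: (gf_const (c := v)).
  + move=> w /=; rewrite cE orbF eq_sym; case: hasP => // -[].
    by exists v; rewrite ?mem_past ?leqnn.
  + exact: mem_head.
  + by rewrite /= size_past; lia.
  by move=> y; rewrite /= eqxx !andbF.
move=> k; apply: ge_ne_recurrence; first exact: oneB_z_neq0.
exact: oneBz_neq0 is_ps_t.
Qed.

(** * The triple [Rge], [Rle], [Rne] *)

Section GeLeNe.
Local Notation completes := (completes Rge Rle Rne).
Local Notation gf_from := (gf_from Rge Rle Rne).

Let R2E v w : holds Rle v w = (v + false <= w)%N.
Proof. by rewrite addn0. Qed.
Let g_eq : z * (1 + z) ^+ false = z. Proof. by rewrite expr0 mulr1. Qed.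

(** Once [v] is placed below the old value [k], any [w >= v] completes the pattern: with first entry
    [v] if [w] differs from [v], and with first entry [k] if [w = v]. *)
Lemma descent_state (past : seq nat) k v : (v < k)%N -> (k <= size past)%N ->
    (forall w, (w <= k)%N -> w \in past) ->
    (forall w, (w <= k)%N -> completes past w = false) ->
  tail_state Rge Rle Rne false (v :: past) (v + false).
Proof.
move=> lt_v le_k mem_past cE; rewrite addn0; split=> [|w|v' w] /=.
- by lia.
- rewrite leqNgt; case: (ltnP w v) => [lt_wv|le_vw] /=.
    by rewrite cE ?andbF //; lia.
  rewrite andbT; apply/orP; left; apply/hasP.
  have [->|neq_wv] := eqVneq w v.
    by exists k; rewrite ?mem_past //; apply/andP; split; lia.
  by exists v; [apply: mem_past; lia|rewrite leqnn eq_sym].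
move=> lt_v' lt_w le_w; apply/orP; right; apply/hasP; exists k.
  exact: mem_past.
by apply/andP; split; lia.
Qed.

(* After 0 1 ... k-1 k followed by at least one more copy of k. *)
Definition repeat_state (past : seq nat) k : Prop :=
  [/\ (k < size past)%N, forall w, (w \in past) = (w <= k)%N &
      forall w, completes past w = (k < w)%N].

Lemma gf_descents past k : (k <= size past)%N ->
    (forall w, (w <= k)%N -> w \in past) ->
    (forall w, (w <= k)%N -> completes past w = false) ->
  z * \sum_(0 <= v < k) weight past v * gf_from (v :: past)
    = (1 + z) ^+ k - 1.
Proof.
move=> le_k mem_past cE; rewrite (gf_tails R2E is_ps_z g_eq) //.
  rewrite [X in _ - X]big_geq //; congr (_ - _).
  rewrite -[X in _ ^+ X]subn0 -prod_const_nat.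
  apply: eq_big_nat => v /andP[_ lt_v]; rewrite weight_in ?mulr1 //.
  exact: mem_past (ltnW lt_v).
by move=> v /andP[_ lt_v]; apply: (descent_state lt_v).
Qed.

(** Further copies of [k] give [1 / (1 - z)]; the strictly decreasing tail is any subset of the
    values below [k]. *)
Lemma gf_repeat past k : repeat_state past k ->
  gf_from past = (1 + z) ^+ k / (1 - z).
Proof.
move=> st; apply: (@gf_from_unique _ _ _ (fun past x =>
  exists2 k, repeat_state past k & x = (1 + z) ^+ k / (1 - z))); last by exists k.
move=> {k st} p x [k [lt_k mem_p cE] ->]; split.
  by apply: is_psM is_psV_oneB_z; apply: is_psX; apply: is_psD (is_ps1 _) is_ps_z.
exists (fun v => if (v < k)%N then gf_from (v :: p) else (1 + z) ^+ k / (1 - z)).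
split=> [v _|].
  rewrite cE -leqNgt leq_eqVlt => /predU1P[->|->]; last by right.
  rewrite ltnn; left; exists k => //; split=> [|w|w] /=; first exact: ltnW.
    by rewrite inE mem_p; case: eqVneq => [->|]; rewrite ?leqnn.
  rewrite cE; case: ltnP => [|le_w]; rewrite ?orbT // orbF.
  apply/negP=> /andP[/hasP[y]]; rewrite mem_p => le_y /andP[le_ky].
  have -> : y = k by apply/eqP; rewrite eqn_leq le_y.
  by rewrite eqn_leq le_w andbT => /negbTE->.
rewrite (big_completes_lt (m := k.+1)) //; last exact: leqW.
rewrite big_nat_recr //= ltnn weight_in ?mem_p // mul1r mulrDr.
have -> : z * \sum_(0 <= v < k) weight p v
    * (if (v < k)%N then gf_from (v :: p) else (1 + z) ^+ k / (1 - z))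
    = (1 + z) ^+ k - 1.
  rewrite -(gf_descents (past := p)) //.
  - by congr (_ * _); apply: eq_big_nat => v /andP[_ ->].
  - exact: ltnW.
  - by move=> w; rewrite mem_p.
  by move=> w le_w; rewrite cE ltnNge le_w.
exact: repeat_recurrence oneB_z_neq0.
Qed.

(** After [0 1 ... k] the next entry repeats [k], drops below [k], or is [k + 1]. The solution is
    shifted by one because the empty prefix has no maximum and allows only the entry 0. *)
Lemma gf_ge_le_ne : gf_avoid Rge Rle Rne =
  1 + z * t * ((1 + z) ^+ 0 / ((1 - z) * (1 - z * (t * (1 + z))))).
Proof.
have ps_1Dz : is_ps (1 + z) := is_psD (is_ps1 _) is_ps_z.
have ps_q : is_ps (t * (1 + z)) := is_psM is_ps_t ps_1Dz.
pose Phi k := (1 + z) ^+ k / ((1 - z) * (1 - z * (t * (1 + z)))).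
have psPhi k : is_ps (Phi k).
  rewrite /Phi invfM; apply: is_psM; first exact: is_psX.
  exact: is_psM is_psV_oneB_z (is_psV ps_q).
apply: (gf_iota
  (Phi := fun k => if k is k'.+1 then Phi k' else 1 + z * t * Phi 0%N)
  (T := fun k => if k is k'.+1 then
     z * ((1 + z) ^+ k' / (1 - z)) + ((1 + z) ^+ k' - 1) else 0)).
- by move=> v w lt_vw /=; rewrite -ltnNge.
- case=> [|k]; last exact: psPhi.
  apply: is_psD (is_ps1 _) _; apply: is_psM (psPhi _).
  exact: is_psM is_ps_z is_ps_t.
- move=> past [|k] [size_past mem_past cE]; first by rewrite big_geq ?mulr0.
  rewrite big_nat_recr //= mulrDr addrC; congr (z * _ + _).
    apply: gf_repeat; split=> [|w|w] /=; first by rewrite size_past.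
      by rewrite inE mem_past ltnS; case: eqVneq => [->|]; rewrite ?leqnn.
    rewrite cE orbF; case: (ltngtP k w) => [lt_kw|//|<-].
    + rewrite andbT; apply/hasP; exists k; first by rewrite mem_past.
      by rewrite leqnn neq_ltn lt_kw.
    + by rewrite andbF.
    rewrite andbT; apply/negbTE/hasPn=> y; rewrite mem_past ltnS => le_y.
    by rewrite negb_and negbK -ltnNge orbC -leq_eqVlt.
  rewrite -(gf_descents (past := past)).
  + congr (_ * _); apply: eq_big_nat => v /andP[_ lt_v].
    by rewrite weight_in ?mul1r // mem_past ltnW.
  + by rewrite size_past.
  + by move=> w; rewrite mem_past ltnS.
  by move=> w _; rewrite cE.
case=> [|k]; first by rewrite addr0.
apply: ge_le_recurrence; first exact: oneB_z_neq0.
exact: oneBz_neq0 ps_q.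
Qed.

End GeLeNe.

(** * Weakly increasing prefixes *)

Section IncreasingRecurrences.
Variable K : fieldType.
Implicit Types x y g k A r : K.

(* In the solutions below, the argument h is (length) - (maximum) of the prefix,
   the room left for the next maximum. *)
Definition incr_sol x k A r (h : nat) : K := A + A * k / (1 - x * r) * r ^+ h.

(** Eliminating the convolution leaves a second-order linear recurrence for [G]. Its constant part
    forces [A * (1 - x + k) = 1], its exponential part is the kernel equation for [r], and the case
    [h = 0] fixes the coefficient of [r ^+ h]. The parameter [k] replaces the quotient
    [x * (1 + g) / g]. *)
Lemma incr_recurrence x y g k A r h :
    1 - x * r != 0 -> g * k = x * (1 + g) -> A * (1 - x + k) = 1 ->
    x * r ^+ 2 - (1 + x - x * y) * r + (1 + g * y) = 0 ->
  incr_sol x k A r h = 1 + x * incr_sol x k A r h.+1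
    + x * y * \sum_(0 <= i < h)
                (1 + g) * (1 + g * y) ^+ i * incr_sol x k A r (h - i).
Proof.
move=> nz gk Ak ker; set C := A * k / (1 - x * r).
pose G h := A + C * r ^+ h; rewrite -![incr_sol _ _ _ _ _]/(G _).
pose S h := \sum_(0 <= i < h) (1 + g) * (1 + g * y) ^+ i * G (h - i)%N.
rewrite -/(S h).
have S_rec n : S n.+1 = (1 + g) * G n.+1 + (1 + g * y) * S n.
  rewrite /S big_nat_recl // expr0 mulr1 subn0 mulr_sumr; congr (_ + _).
  by apply: eq_bigr => i _; rewrite subSS exprS; ring.
have G0 : G 0%N - 1 - x * G 1%N = 0.
  have CE : C * (1 - x * r) = A * k by rewrite /C; field.
  transitivity (A * (1 - x) + C * (1 - x * r) - 1); first by rewrite /G; ring.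
  by rewrite CE -mulrDr Ak subrr.
have G_rec n : x * y * (1 + g) * G n.+1
    + (1 + g * y) * (G n - 1 - x * G n.+1) = G n.+1 - 1 - x * G n.+2.
  apply/eqP; rewrite -subr_eq0; apply/eqP.
  have ker2 : r * x * y * (1 + g) + (1 + g * y) - (1 + g * y) * x * r - r
      + x * r ^+ 2 = 0.
    by rewrite -[RHS]ker; ring.
  transitivity (C * r ^+ n * (r * x * y * (1 + g) + (1 + g * y)
      - (1 + g * y) * x * r - r + x * r ^+ 2)
    + y * (A * (x * (1 + g)) + g * (A * (1 - x) - 1))).
    by rewrite /G !exprS; ring.
  rewrite ker2 mulr0 add0r -gk.
  transitivity (y * g * (A * (1 - x + k) - 1)); first by ring.
  by rewrite Ak subrr mulr0.
suff -> : x * y * S h = G h - 1 - x * G h.+1 by ring.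
elim: h => [|h IHh]; first by rewrite /S big_geq // mulr0 G0.
by rewrite S_rec -G_rec -IHh; ring.
Qed.

Definition incr_const_sol x r (h : nat) : K := r ^+ h / (1 - x * r).

(** The forcing term contains multiples of [r ^+ h], which already solves the homogeneous
    second-order recurrence; this resonance causes the term linear in [h]. *)
Definition incr_lin_sol x r (h : nat) : K :=
  (1 - x)^-1
  + (x * (r - 1) / ((1 - x) * (1 - x * r) * (1 - x * r ^+ 2))
     + h%:R * ((1 - r^-1) / ((1 - x) * (1 - x * r ^+ 2)))) * r ^+ h.

Lemma scaled_recurrence (x y p a b : K) :
  p * (1 + x * a + x * y * b)
    = 1 + (p - 1) + x * (p * a) + x * y * (p * b).
Proof. by ring. Qed.

Section LinearRecurrences.
Variables x y r : K.
Hypotheses (x_neq0 : x != 0) (r_neq0 : r != 0) (nz1 : 1 - x != 0).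
Hypotheses (nz2 : 1 - x * r != 0) (nz3 : 1 - x * r ^+ 2 != 0).
Hypothesis ker : x * r ^+ 2 - (1 + x - x * y) * r + 1 = 0.

(** The kernel equation is linear in [y]; substituting its solution turns identities modulo a
    quadratic relation into rational identities in [x] and [r]. *)
Lemma ker_yE : y = (1 - x * r) * (r - 1) / (x * r).
Proof.
apply: (mulIf (mulf_neq0 x_neq0 r_neq0)); rewrite divfK ?mulf_neq0 //.
by apply/eqP; rewrite -subr_eq0 -ker; apply/eqP; ring.
Qed.

Lemma incr_const_recurrence h :
  incr_const_sol x r h = 1 + x * incr_const_sol x r h.+1
    + x * y * \sum_(0 <= i < h) incr_const_sol x r (h - i).
Proof.
suff -> : x * y * \sum_(0 <= i < h) incr_const_sol x r (h - i)
    = incr_const_sol x r h - 1 - x * incr_const_sol x r h.+1 by ring.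
rewrite ker_yE /incr_const_sol; elim: h => [|h IHh].
  by rewrite big_geq // mulr0 expr0 expr1; field.
rewrite big_nat_recl // subn0 mulrDr; under eq_bigr do rewrite subSS.
by rewrite IHh !exprS; field; apply/and3P.
Qed.

Lemma incr_lin_recurrence h :
  incr_lin_sol x r h = 1 + x * incr_lin_sol x r h.+1
    + x * y * \sum_(0 <= i < h)
        (x / (1 - x) * (1 + i%:R * y) * incr_const_sol x r (h - i)
           + incr_lin_sol x r (h - i)).
Proof.
suff -> : x * y * \sum_(0 <= i < h)
        (x / (1 - x) * (1 + i%:R * y) * incr_const_sol x r (h - i)
           + incr_lin_sol x r (h - i))
    = incr_lin_sol x r h - 1 - x * incr_lin_sol x r h.+1 by ring.
elim: h => [|h IHh].
  rewrite big_geq // mulr0 /incr_lin_sol mul0r mul1r expr0 expr1.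
  by field; rewrite nz1 nz2 nz3 r_neq0.
rewrite big_nat_recl // subn0 mulr0n mul0r addr0 mulr1.
(* Shifting [i] raises the linear weight by [y], which produces the sum evaluated by
   [incr_const_recurrence]. *)
have -> : \sum_(0 <= i < h) (x / (1 - x) * (1 + i.+1%:R * y)
      * incr_const_sol x r (h.+1 - i.+1) + incr_lin_sol x r (h.+1 - i.+1))
  = \sum_(0 <= i < h) (x / (1 - x) * (1 + i%:R * y)
      * incr_const_sol x r (h - i) + incr_lin_sol x r (h - i))
    + x / (1 - x) * y * \sum_(0 <= i < h) incr_const_sol x r (h - i).
  rewrite mulr_sumr -big_split; apply: eq_bigr => i _ /=.
  by rewrite subSS -natr1; ring.
rewrite [LHS]mulrDr [X in _ + X]mulrDr IHh.
have -> : x * y * (x / (1 - x) * y * \sum_(0 <= i < h) incr_const_sol x r (h - i))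
  = x / (1 - x) * y * (incr_const_sol x r h - 1 - x * incr_const_sol x r h.+1).
  by rewrite (incr_const_recurrence h); ring.
rewrite ker_yE /incr_const_sol /incr_lin_sol -[h.+2%:R]natr1 -natr1 !exprS.
by field; rewrite -expr2 nz1 nz2 nz3 r_neq0 x_neq0.
Qed.

End LinearRecurrences.

End IncreasingRecurrences.

Section IncreasingClasses.
Implicit Types (past : seq nat) (M : nat).

Lemma weight_incr past M (u i : nat) : (forall w, w \in past -> (w <= M)%N) ->
  (M < u < i + M.+1)%N -> weight (i + M.+1 :: past)%N u = t.
Proof.
move=> le_M /andP[lt_Mu lt_u]; rewrite weight_notin // inE negb_or.
by rewrite neq_ltn lt_u; apply/negP=> /le_M; rewrite leqNgt lt_Mu.
Qed.

(** The values below the new maximum are those below [M], with unchanged weights, then [M] itself,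
    then [i] skipped values, all absent so far. The general law covers both products and sums of
    weights. *)
Lemma big_incr (T : Type) (idx : T) (op : Monoid.law idx) (f : genfun -> T)
    past M i :
    M \in past -> (forall w, w \in past -> (w <= M)%N) ->
  \big[op/idx]_(0 <= u < i + M.+1) f (weight (i + M.+1 :: past)%N u)
  = op (\big[op/idx]_(0 <= u < M) f (weight past u))
       (op (f 1) (\big[op/idx]_(0 <= u < i) f t)).
Proof.
move=> M_in le_M; have le_Mi : (M <= i + M.+1)%N by rewrite addnS leqW ?leq_addl.
rewrite (big_cat_nat (leq0n M) le_Mi) [\big[op/idx]_(M <= _ < _) _]big_ltn;
  last by rewrite addnS ltnS leq_addl.
congr (op _ (op _ _)).
- apply: eq_big_nat => u /andP[_ lt_u]; rewrite weight_cons //.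
  by apply/eqP; lia.
- by rewrite weight_in // inE M_in orbT.
rewrite -[X in index_iota X _]add0n big_addn addnK.
apply: eq_big_nat => u /andP[_ lt_u]; rewrite weight_incr //.
by lia.
Qed.

Section Tail.
Variables (R2 : relsym) (d : bool) (g k A r : genfun).
Hypothesis R2E : forall v w, holds R2 v w = (v + d <= w)%N.
Hypotheses (ps_g : is_ps g) (ps_k : is_ps k) (ps_A : is_ps A) (ps_r : is_ps r).
Hypothesis g_eq : z * (1 + g) ^+ d = g.
Hypotheses (gk : g * k = z * (1 + g)) (Ak : A * (1 - z + k) = 1).
Hypothesis ker : z * r ^+ 2 - (1 + z - z * t) * r + (1 + g * t) = 0.

(** An entry [v < M] forms a descent with [M] and forbids every later [w] with [R2 v w]. The
    solution is the tail product below [M] times a function of [size past - M]; raising the maximum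
    multiplies the product by [(1 + g) * (1 + g * t) ^+ i]. *)
Lemma gf_gt_any :
  gf_avoid Rgt R2 Rany = 1 + z * t * incr_sol z k A r 1.
Proof.
pose P past M := \prod_(0 <= u < M) (1 + g * weight past u).
have -> : incr_sol z k A r 1
    = P [:: 0%N] 0%N * incr_sol z k A r (size [:: 0%N] - 0).
  by rewrite /P big_geq // mul1r.
apply: (gf_incr
  (Phi := fun past M => P past M * incr_sol z k A r (size past - M))).
- by [].
- move=> past M; apply: is_psM.
    apply: is_ps_prod => u _; apply: is_psD (is_ps1 _) _.
    exact: is_psM ps_g (is_ps_weight _ _).
  apply: is_psD ps_A _; apply: is_psM; last exact: is_psX.
  by apply: is_psM (is_psV ps_r); apply: is_psM.
move=> past M [M_in le_M lt_M cE].
rewrite (gf_tails R2E ps_g g_eq (leq0n M)); last first.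
  move=> v /andP[_ lt_v]; split=> [|w|v' w lt_v' lt_w le_w] /=.
  - by case: (d); lia.
  - rewrite cE orbF R2E; case: hasP => // -[]; exists M => //=.
    by rewrite lt_v.
  apply/orP; right; apply/hasP; exists M => //=.
  by rewrite andbT; move: lt_v'; case: (d); lia.
rewrite -/(P past M) [X in P past M - X]big_geq //.
have -> : P (M :: past) M = P past M.
  apply: eq_big_nat => u /andP[_ lt_u].
  by rewrite weight_cons // neq_ltn lt_u.
rewrite /= subSn ?(ltnW lt_M) //.
have -> : \sum_(0 <= i < size past - M) P (i + M.+1 :: past)%N (i + M.+1)%N
      * incr_sol z k A r ((size past).+1 - (i + M.+1))
  = P past M * \sum_(0 <= i < size past - M)
      (1 + g) * (1 + g * t) ^+ i * incr_sol z k A r (size past - M - i).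
  rewrite mulr_sumr; apply: eq_bigr => i _.
  rewrite /P (big_incr _ (fun w => 1 + g * w)) // prod_const_nat subn0 mulr1.
  by rewrite mulrA addnS subSS addnC subnDA.
rewrite [in LHS](incr_recurrence _ _ gk Ak ker); last exact: oneBz_neq0 ps_r.
exact: scaled_recurrence.
Qed.

End Tail.

End IncreasingClasses.

(** The part proportional to [w] follows the recurrence of [a]; the increments [1 + y *+ i] of the
    weight feed that of [b]. *)
Lemma affine_recurrence (K : comPzRingType) (x y s w : K) (a b : nat -> K) h :
    a h = 1 + x * a h.+1 + x * y * \sum_(0 <= i < h) a (h - i)%N ->
    b h = 1 + x * b h.+1
      + x * y * \sum_(0 <= i < h) (s * (1 + i%:R * y) * a (h - i)%N + b (h - i)%N) ->
  s * w * a h + b h = 1 + s * w + x * (s * w * a h.+1 + b h.+1)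
    + x * y * \sum_(0 <= i < h)
        (s * (w + (1 + y *+ i)) * a (h - i)%N + b (h - i)%N).
Proof.
move=> aE bE.
have -> : \sum_(0 <= i < h) (s * (w + (1 + y *+ i)) * a (h - i)%N + b (h - i)%N)
  = s * w * \sum_(0 <= i < h) a (h - i)%N
    + \sum_(0 <= i < h) (s * (1 + i%:R * y) * a (h - i)%N + b (h - i)%N).
  rewrite mulr_sumr -big_split; apply: eq_bigr => i _ /=.
  by rewrite -mulr_natl; ring.
by rewrite [in LHS]aE [in LHS]bE; ring.
Qed.

(** * The quadratic kernel *)

Section QuadraticKernel.
Variable K : fieldType.
Implicit Types x y r : K.

(** The equation reads [r * (1 + x - x * y - x * r) = 1]; thus [r^-1] is a power series whenever
    [x], [y] and [r] are. *)
Lemma kernel_inv x y r : x * r ^+ 2 - (1 + x - x * y) * r + 1 = 0 ->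
  r != 0 /\ r^-1 = 1 + x - x * y - x * r.
Proof.
move=> ker; have e : r * (1 + x - x * y - x * r) = 1.
  by apply/eqP; rewrite -subr_eq0 -oppr_eq0 -ker; apply/eqP; ring.
have nz : r != 0 by apply: contra_eq_neq e => ->; rewrite mul0r eq_sym oner_eq0.
by split=> //; apply: (mulfI nz); rewrite mulfV.
Qed.

Lemma half_root x y h f : x != 0 -> 2 != 0 :> K ->
    (1 + x * (1 - y) - x * h) ^+ 2
      = 1 + x * (2 * (1 - y) + x * (1 - y) ^+ 2 - 4 * f) ->
  x * (h / 2) ^+ 2 - (1 + x - x * y) * (h / 2) + f = 0.
Proof.
move=> nz nz2 e; apply: (mulfI (mulf_neq0 nz (mulf_neq0 nz2 nz2))).
rewrite mulr0; move/eqP: e; rewrite -subr_eq0 => /eqP <-.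
by field.
Qed.

Lemma disc_expand x y f : (1 + x - x * y) ^+ 2 - 4 * x * f
  = 1 + x * (2 * (1 - y) + x * (1 - y) ^+ 2 - 4 * f).
Proof. by ring. Qed.

Lemma half_cancel x y h : 2 != 0 :> K ->
  1 + x * (1 - y) - x * h = 1 + x - x * y - 2 * x * (h / 2).
Proof. by move=> nz2; field. Qed.

End QuadraticKernel.

(** After an entry [v < M], the descent from [M] to [v] allows only further copies of [v]. These
    constant tails make the solution affine in the total weight [W] of the values below [M]. *)
Lemma gf_gt_ne_any (r : genfun) : is_ps r ->
    z * r ^+ 2 - (1 + z - z * t) * r + 1 = 0 ->
  gf_avoid Rgt Rne Rany = 1 + z * t * incr_lin_sol z r 1.
Proof.
move=> ps_r ker; pose s : genfun := z / (1 - z).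
have ps_s : is_ps s := is_psM is_ps_z is_psV_oneB_z.
have [r_neq0 rV] := kernel_inv ker.
have ps_rV : is_ps r^-1.
  rewrite rV; apply: is_psD; last exact: is_psN (is_psM is_ps_z ps_r).
  apply: is_psD; last exact: is_psN (is_psM is_ps_z is_ps_t).
  exact: is_psD (is_ps1 _) is_ps_z.
have nz1 : 1 - z != 0 := oneB_z_neq0.
have nz2 : 1 - z * r != 0 := oneBz_neq0 ps_r.
have ps_V := is_psV (is_psX 2 ps_r).
have nz3 : 1 - z * r ^+ 2 != 0 := oneBz_neq0 (is_psX 2 ps_r).
have ps_V2 : is_ps ((1 - z) * (1 - z * r ^+ 2))^-1.
  by rewrite invfM; apply: is_psM is_psV_oneB_z ps_V.
have ps_V3 : is_ps ((1 - z) * (1 - z * r) * (1 - z * r ^+ 2))^-1.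
  rewrite invfM; apply: is_psM ps_V; rewrite invfM.
  exact: is_psM is_psV_oneB_z (is_psV ps_r).
pose W past M := \sum_(0 <= u < M) weight past u.
have -> : incr_lin_sol z r 1 = s * W [:: 0%N] 0%N
    * incr_const_sol z r (size [:: 0%N] - 0)
    + incr_lin_sol z r (size [:: 0%N] - 0).
  by rewrite /W big_geq // mulr0 mul0r add0r.
apply: (gf_incr (Phi := fun past M =>
  s * W past M * incr_const_sol z r (size past - M)
    + incr_lin_sol z r (size past - M))).
- by [].
- move=> past M; apply: is_psD.
    apply: is_psM; last by apply: is_psM (is_psV ps_r); apply: is_psX.
    by apply: is_psM ps_s _; apply: is_ps_sum => u _; apply: is_ps_weight.
  apply: is_psD is_psV_oneB_z _; apply: is_psM; last exact: is_psX.
  apply: is_psD.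
    apply: is_psM ps_V3; apply: is_psM is_ps_z _.
    exact: is_psD ps_r (is_psN (is_ps1 _)).
  apply: is_ps_natM; apply: is_psM ps_V2.
  exact: is_psD (is_ps1 _) (is_psN ps_rV).
move=> past M [M_in le_M lt_M cE].
have -> : z * \sum_(0 <= v < M) weight past v * gf_from Rgt Rne Rany (v :: past)
    = s * W past M.
  transitivity (z * (W past M * (1 - z)^-1)); last first.
    rewrite mulrA mulrAC; reflexivity.
  rewrite mulr_suml; congr (_ * _).
  apply: eq_big_nat => v /andP[_ lt_v]; congr (_ * _).
  apply: (gf_const (c := v)).
  + move=> w /=; rewrite cE orbF [w == v]eq_sym; case: hasP => // -[].
    by exists M; rewrite ?lt_v.
  + exact: mem_head.
  + by rewrite /= (leq_trans (ltnW lt_v)) // ltnW // ltnW.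
  by move=> y; rewrite /= eqxx !andbF.
have -> : W (M :: past) M = W past M.
  apply: eq_big_nat => u /andP[_ lt_u].
  by rewrite weight_cons // neq_ltn lt_u.
rewrite /= subSn ?(ltnW lt_M) //.
have -> : \sum_(0 <= i < size past - M)
      (s * W (i + M.+1 :: past)%N (i + M.+1)%N
         * incr_const_sol z r ((size past).+1 - (i + M.+1))
       + incr_lin_sol z r ((size past).+1 - (i + M.+1)))
  = \sum_(0 <= i < size past - M)
      (s * (W past M + (1 + t *+ i)) * incr_const_sol z r (size past - M - i)
       + incr_lin_sol z r (size past - M - i)).
  apply: eq_bigr => i _.
  rewrite /W (big_incr _ id) // sumr_const_nat subn0.
  by rewrite addnS subSS addnC subnDA.
apply: affine_recurrence.
  exact: (incr_const_recurrence z_neq0 r_neq0 nz2 ker).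
exact: (incr_lin_recurrence z_neq0 r_neq0 nz1 nz2 nz3 ker).
Qed.

Lemma two_neq0 : (2 : genfun) != 0.
Proof.
rewrite -(rmorph_nat (@FracField.tofrac (fps {poly rat}))) tofrac_eq0.
apply/eqP=> /fpsP/(_ 0%N)/eqP.
by rewrite mulr2n coefsD coefs0 -mulr2n -polyC_natr polyC_eq0.
Qed.

Lemma is_ps_half : is_ps (2 : genfun)^-1.
Proof.
exists (fpsC ((2 : rat)^-1)%:P); apply: (mulIf two_neq0); rewrite mulVf ?two_neq0 //.
rewrite -(rmorph_nat (@FracField.tofrac (fps {poly rat}))) -tofracM -tofrac1.
congr (FracField.tofrac _); apply/fpsP=> -[|n].
  rewrite mulr_natr mulr2n coefsD [RHS]/= -polyCD -mulr2n -[_ *+ 2]mulr_natr.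
  by rewrite mulVf.
by rewrite mulr_natr mulr2n coefsD /= addr0.
Qed.

(** The root is [(1 + z - z * t - s) / (2 * z)], where [s] is the square root of the discriminant
    with constant coefficient 1; this choice of sign makes the numerator divisible by [z]. *)
Lemma kernel_root (b : genfun) : is_ps b -> exists r : genfun, [/\ is_ps r,
  z * r ^+ 2 - (1 + z - z * t) * r + b = 0 &
  series_sqrt ((1 + z - z * t) ^+ 2 - 4 * z * b) = 1 + z - z * t - 2 * z * r].
Proof.
move=> [f ->].
pose X := fpsX {poly rat}; pose c := 1 - fpsC ('X : {poly rat}).
(* The discriminant, in the form of [disc_expand] that displays its constant coefficient 1. *)
pose D := 1 + X * (2 * c + X * c ^+ 2 - 4 * f).
have D0 : coefs D 0 = 1 by rewrite coefsD coefsXM coefs1 addr0.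
have u2 : (2%:R : {poly rat}) \is a GRing.unit.
  by rewrite -polyC_natr poly_unitE coefC size_polyC /= unitfE.
have [s s0 s2] := fps_sqrt_exists u2 D0.
have two_neq0' : (2%:R : {poly rat}) != 0.
  by apply: contraTneq u2 => ->; rewrite unitr0.
have [h hE] : exists h, 1 + X * c - s = X * h.
  by apply: fpsX_dvd; rewrite coefsB coefsD coefsXM coefs1 s0 addr0 subrr.
have zE : X%:F = z by [].
have cE : c%:F = 1 - t by rewrite tofracB tofrac1.
have sE : s%:F = 1 + z * (1 - t) - z * h%:F.
  rewrite -zE -cE -!tofracM -tofrac1 -tofracD -tofracB -hE.
  by congr (FracField.tofrac _); rewrite opprB addrC subrK.
have DE : D%:F = 1 + z * (2 * (1 - t) + z * (1 - t) ^+ 2 - 4 * f%:F).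
  rewrite /D tofracD tofracM tofracB tofracD [(2 * c)%:F]tofracM.
  rewrite [(X * _)%:F]tofracM [(4 * f)%:F]tofracM tofracXn tofrac1 zE cE.
  rewrite !(rmorph_nat (@FracField.tofrac (fps {poly rat}))); reflexivity.
exists (h%:F / 2); split.
- exact: is_psM (is_ps_tofrac _) is_ps_half.
- have e : s%:F ^+ 2 = D%:F by rewrite -tofracXn s2.
  move: e; rewrite sE DE.
  exact: half_root z_neq0 two_neq0.
have -> : (1 + z - z * t) ^+ 2 - 4 * z * f%:F = (s ^+ 2)%:F.
  rewrite s2 DE.
  exact: disc_expand.
rewrite series_sqrtE // sE; exact: half_cancel two_neq0.
Qed.

End GeneratingFunctions.

(** * Closed forms *)

Section ClosedForms.
Variable K : fieldType.
Variables z t : K.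
Implicit Types r : K.
Hypothesis nz : 1 - z != 0.

Lemma closed_lt_any_lt :
  1 + z * t * ((1 - z)^-1 + t * (1%:R * z / (1 - z) ^+ 2
                                  + z ^+ 2 / (1 - z) ^+ 3)) =
    (1 - 3 * z + z * t + 3 * z ^+ 2 - 2 * z ^+ 2 * t + z ^+ 2 * t ^+ 2
       - z ^+ 3 + z ^+ 3 * t)
    / (1 - z) ^+ 3.
Proof. by field. Qed.

Lemma weak_step : z * (1 + z / (1 - z)) ^+ true = z / (1 - z).
Proof. by rewrite expr1; field. Qed.

Lemma strict_step : z * (1 + z) ^+ false = z.
Proof. by rewrite expr0 mulr1. Qed.

Lemma closed_ne_lt_any : 1 - 2 * z + z ^+ 2 - z ^+ 2 * t != 0 ->
  1 + z * t * ((1 + z / (1 - z)) * (1 + z / (1 - z) * t)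
                 / (1 - z * (1 + z / (1 - z) * t)) - z / (1 - z) / (1 - z)) =
    (1 - 4 * z + z * t + 6 * z ^+ 2 - 4 * z ^+ 2 * t + z ^+ 2 * t ^+ 2
       - 4 * z ^+ 3 + 5 * z ^+ 3 * t - z ^+ 3 * t ^+ 2
       + z ^+ 4 - 2 * z ^+ 4 * t + z ^+ 4 * t ^+ 2)
    / ((1 - z) ^+ 2 * (1 - 2 * z + z ^+ 2 - z ^+ 2 * t)).
Proof.
move=> nz2.
have -> : 1 - z * (1 + z / (1 - z) * t)
  = (1 - 2 * z + z ^+ 2 - z ^+ 2 * t) / (1 - z) by field.
by field; apply/andP.
Qed.

Lemma closed_ne_le_any : 1 - z - z ^+ 2 * t != 0 ->
  1 + z * t * ((1 + z) * (1 + z * t) / (1 - z * (1 + z * t)) - z / (1 - z)) =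
    (1 - 2 * z + z * t + z ^+ 2 - 2 * z ^+ 2 * t + z ^+ 2 * t ^+ 2
       + z ^+ 3 * t)
    / ((1 - z) * (1 - z - z ^+ 2 * t)).
Proof.
move=> nz2.
have -> : 1 - z * (1 + z * t) = 1 - z - z ^+ 2 * t by ring.
by field; apply/andP.
Qed.

(** The kernel equation cancels the factor [1 - z * r] of the denominator; what remains is linear in
    [r], hence in the square root. *)
Lemma closed_gt_lt_any r : z != 0 -> 2 != 0 :> K -> 2 - z != 0 ->
    1 - z * r != 0 ->
    z * r ^+ 2 - (1 + z - z * t) * r + (1 + z / (1 - z) * t) = 0 ->
  1 + z * t * incr_sol z 1 (2 - z)^-1 r 1 =
    (1 + z * (2 - t) - z ^+ 2 * (1 - t)
       - (1 - z) * (1 + z - z * t - 2 * z * r))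
    / (2 * z * (2 - z)).
Proof.
move=> z0 nz2 nz2z nzr ker.
have e : z * t * (1 + r - z * r) = (1 - z * r) * (1 - z) * (r - 1).
  apply/eqP; rewrite -subr_eq0 -[X in _ == X](mulr0 (1 - z)) -ker; apply/eqP.
  by field.
transitivity (1 + z * t * (1 + r - z * r) / ((1 - z * r) * (2 - z))).
  by rewrite /incr_sol; field; apply/andP.
by rewrite e; field; rewrite nz2z z0 nz2 nzr.
Qed.

Lemma closed_gt_le_any r : z != 0 -> 2 != 0 :> K ->
    1 - z * r != 0 ->
    z * r ^+ 2 - (1 + z - z * t) * r + (1 + z * t) = 0 ->
  1 + z * t * incr_sol z (1 + z) 2^-1 r 1 =
    (1 + z * (3 - t) - (1 + z - z * t - 2 * z * r)) / (4 * z).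
Proof.
move=> z0 nz2 nzr ker.
have e : z * t * (1 + r) = (1 - z * r) * (r - 1).
  by apply/eqP; rewrite -subr_eq0 -ker; apply/eqP; ring.
transitivity (1 + z * t * (1 + r) / ((1 - z * r) * 2)).
  by rewrite /incr_sol; field; apply/andP.
have nz4 : 4 != 0 :> K by rewrite [4](natrM K 2 2) mulf_neq0.
by rewrite e; field; rewrite z0 nz4 nz2 nzr.
Qed.

Lemma closed_gt_ne_any r : z != 0 -> 2 != 0 :> K -> r != 0 ->
    1 - z * r != 0 -> 1 - z * r ^+ 2 != 0 ->
    z * r ^+ 2 - (1 + z - z * t) * r + 1 = 0 ->
  1 + z * t * incr_lin_sol z r 1 =
    (1 - 2 * z + z ^+ 2 * (1 - t) ^+ 2
       + (1 - z + z * t) * (1 + z - z * t - 2 * z * r))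
    / (2 * (1 - z) * (1 + z - z * t - 2 * z * r)).
Proof.
move=> z0 nz2 r0 nzr nzr2 ker.
(* The kernel equation gives [1 + z - z * t = z * r + 1 / r], so the square root equals
   [1 / r - z * r]. *)
have -> : 1 + z - z * t - 2 * z * r = (1 - z * r ^+ 2) / r.
  by rewrite (ker_yE z0 r0 ker); field; apply/andP.
rewrite (ker_yE z0 r0 ker) /incr_lin_sol; by field; rewrite r0 nzr2 nz nz2 z0 nzr.
Qed.

(** This and the next three identities give denominators the shape required by [oneBz_neq0]. *)
Lemma ne_lt_denomE : 1 - 2 * z + z ^+ 2 - z ^+ 2 * t = 1 - z * (2 - z + z * t).
Proof. by ring. Qed.
Lemma ne_le_denomE : 1 - z - z ^+ 2 * t = 1 - z * (1 + z * t).
Proof. by ring. Qed.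
Lemma eq_lt_denomE : 1 - z - z * t = 1 - z * (1 + t).
Proof. by ring. Qed.
Lemma eq_le_denomE : 1 - z * t - z ^+ 2 * t = 1 - z * (t + z * t).
Proof. by ring. Qed.

Lemma weak_kappa : z / (1 - z) * 1 = z * (1 + z / (1 - z)).
Proof. by field. Qed.
Lemma weak_A : 1 - z + 1 = 2 - z.
Proof. by ring. Qed.
Lemma strict_A : 1 - z + (1 + z) = 2.
Proof. by ring. Qed.

Lemma disc_weak : (1 + z - z * t) ^+ 2 - 4 * z * (1 - z + z * t) / (1 - z)
  = (1 + z - z * t) ^+ 2 - 4 * z * (1 + z / (1 - z) * t).
Proof. by field. Qed.

Lemma disc_strict : 1 - z * (2 + 2 * t - z + 6 * z * t - z * t ^+ 2)
  = (1 + z - z * t) ^+ 2 - 4 * z * (1 + z * t).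
Proof. by ring. Qed.

Lemma two_minusE : 2 != 0 :> K -> 2 - z = 2 * (1 - z * 2^-1).
Proof. by move=> nz2; field. Qed.

Lemma closed_ge_ne_any : 1 - z * t != 0 ->
  (1 + z ^+ 2 * t / ((1 - z) * (1 - z * t))) / (1 - z * t)
    + 0%:R * (z / ((1 - z) * (1 - z * t))) =
    (1 - z - z * t + 2 * z ^+ 2 * t) / ((1 - z) * (1 - z * t) ^+ 2).
Proof. by move=> nz2; field; apply/andP. Qed.

Lemma closed_eq_lt_any : 1 - z - z * t != 0 ->
  (1 - z * (t * (1 + z / (1 - z))))^-1 = (1 - z) / (1 - z - z * t).
Proof.
move=> nz2.
have -> : 1 - z * (t * (1 + z / (1 - z))) = (1 - z - z * t) / (1 - z) by field.
by rewrite invf_div.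
Qed.

Lemma closed_eq_le_any :
  (1 - z * (t * (1 + z)))^-1 = 1 / (1 - z * t - z ^+ 2 * t).
Proof. by rewrite div1r; congr (_^-1); ring. Qed.

Lemma closed_ge_le_ne : 1 - z * t - z ^+ 2 * t != 0 ->
  1 + z * t * ((1 + z) ^+ 0 / ((1 - z) * (1 - z * (t * (1 + z))))) =
    (1 - z + z ^+ 3 * t) / ((1 - z) * (1 - z * t - z ^+ 2 * t)).
Proof.
move=> nz2.
have -> : 1 - z * (t * (1 + z)) = 1 - z * t - z ^+ 2 * t by ring.
by rewrite expr0; field; apply/andP.
Qed.

End ClosedForms.


Theorem theorem5p4 :
  let z := gf_z in
  let t := gf_t in
  let I := gf_avoid in
  I Rlt Rany Rlt =
    (1 - 3 * z + z * t + 3 * z ^+ 2 - 2 * z ^+ 2 * t + z ^+ 2 * t ^+ 2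
       - z ^+ 3 + z ^+ 3 * t)
    / (1 - z) ^+ 3
  /\
  I Rne Rlt Rany =
    (1 - 4 * z + z * t + 6 * z ^+ 2 - 4 * z ^+ 2 * t + z ^+ 2 * t ^+ 2
       - 4 * z ^+ 3 + 5 * z ^+ 3 * t - z ^+ 3 * t ^+ 2
       + z ^+ 4 - 2 * z ^+ 4 * t + z ^+ 4 * t ^+ 2)
    / ((1 - z) ^+ 2 * (1 - 2 * z + z ^+ 2 - z ^+ 2 * t))
  /\
  I Rne Rle Rany =
    (1 - 2 * z + z * t + z ^+ 2 - 2 * z ^+ 2 * t + z ^+ 2 * t ^+ 2
       + z ^+ 3 * t)
    / ((1 - z) * (1 - z - z ^+ 2 * t))
  /\
  I Rgt Rlt Rany =
    (1 + z * (2 - t) - z ^+ 2 * (1 - t)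
       - (1 - z) * series_sqrt ((1 + z - z * t) ^+ 2
                                - 4 * z * (1 - z + z * t) / (1 - z)))
    / (2 * z * (2 - z))
  /\
  I Rgt Rle Rany =
    (1 + z * (3 - t)
       - series_sqrt (1 - z * (2 + 2 * t - z + 6 * z * t - z * t ^+ 2)))
    / (4 * z)
  /\
  I Rgt Rne Rany =
    (1 - 2 * z + z ^+ 2 * (1 - t) ^+ 2
       + (1 - z + z * t) * series_sqrt ((1 + z - z * t) ^+ 2 - 4 * z))
    / (2 * (1 - z) * series_sqrt ((1 + z - z * t) ^+ 2 - 4 * z))
  /\
  I Rge Rne Rany =
    (1 - z - z * t + 2 * z ^+ 2 * t) / ((1 - z) * (1 - z * t) ^+ 2)
  /\
  I Req Rlt Rany = (1 - z) / (1 - z - z * t)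
  /\
  I Req Rle Rany = 1 / (1 - z * t - z ^+ 2 * t)
  /\
  I Rge Rle Rne =
    (1 - z + z ^+ 3 * t) / ((1 - z) * (1 - z * t - z ^+ 2 * t)).
Proof.
move=> z t I.
have nz1 : 1 - z != 0 := oneB_z_neq0.
have ps1 : is_ps (1 : genfun) := is_ps1 _.
have ps_z : is_ps z := is_ps_z.
have ps_t : is_ps t := is_ps_t.
have ps_zt : is_ps (z * t) := is_psM ps_z ps_t.
have ps_w : is_ps (z / (1 - z)) := is_psM ps_z is_psV_oneB_z.
(* The flag [d] is the strictness of [R2]: [Rlt] goes with weakly decreasing tails and
   [g = z / (1 - z)], [Rle] with strictly decreasing tails and [g = z]. *)
have ltE v w : holds Rlt v w = (v + true <= w)%N by rewrite addn1.
have leE v w : holds Rle v w = (v + false <= w)%N by rewrite addn0.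
have w_eq := weak_step nz1.
have s_eq := strict_step z.
split; first by rewrite /I gf_lt_any_lt; exact: (closed_lt_any_lt t nz1).
split.
  rewrite /I (gf_ne_any ltE ps_w w_eq); apply: (closed_ne_lt_any nz1).
  rewrite ne_lt_denomE; apply: oneBz_neq0; apply: is_psD ps_zt.
  exact: is_psD (is_psMn 2 ps1) (is_psN ps_z).
split.
  rewrite /I (gf_ne_any leE ps_z s_eq); apply: (closed_ne_le_any nz1).
  rewrite ne_le_denomE; apply: oneBz_neq0; exact: is_psD ps1 ps_zt.
split.
  have [r [ps_r ker sqrtE]] := kernel_root (is_psD ps1 (is_psM ps_w ps_t)).
  have nz2z : 2 - z != 0.
    rewrite (two_minusE z two_neq0); apply: mulf_neq0 two_neq0 _.
    exact: oneBz_neq0 is_ps_half.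
  have ps_A : is_ps (2 - z)^-1.
    rewrite (two_minusE z two_neq0) invfM.
    exact: is_psM is_ps_half (is_psV is_ps_half).
  rewrite (disc_weak t nz1) sqrtE /I.
  (* Here [k = 1], so [A] is the inverse of [1 - z + 1]. *)
  rewrite (gf_gt_any ltE ps_w ps1 ps_A ps_r w_eq _ _ ker).
  - exact: (closed_gt_lt_any nz1 z_neq0 two_neq0 nz2z (oneBz_neq0 ps_r) ker).
  - exact: (weak_kappa nz1).
  rewrite weak_A; exact: (mulVf nz2z).
split.
  have [r [ps_r ker sqrtE]] := kernel_root (is_psD ps1 ps_zt).
  rewrite disc_strict sqrtE /I.
  (* Here [k = 1 + z], so [A] is the inverse of [1 - z + (1 + z) = 2]. *)
  rewrite (gf_gt_any leE ps_z (is_psD ps1 ps_z) is_ps_half ps_r s_eq _ _ ker).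
  - exact: (closed_gt_le_any z_neq0 two_neq0 (oneBz_neq0 ps_r) ker).
  - reflexivity.
  rewrite strict_A; exact: mulVf two_neq0.
split.
  have [r [ps_r ker]] := kernel_root ps1; rewrite mulr1 => sqrtE.
  rewrite sqrtE /I (gf_gt_ne_any ps_r ker).
  have [r_neq0 _] := kernel_inv ker.
  exact: (closed_gt_ne_any nz1 z_neq0 two_neq0 r_neq0 (oneBz_neq0 ps_r)
    (oneBz_neq0 (is_psX 2 ps_r)) ker).
split.
  rewrite /I gf_ge_ne_any; exact: (closed_ge_ne_any nz1 (oneBz_neq0 ps_t)).
split.
  rewrite /I (gf_eq_any ltE ps_w w_eq); apply: (closed_eq_lt_any nz1).
  rewrite eq_lt_denomE; apply: oneBz_neq0; exact: is_psD ps1 ps_t.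
split.
  rewrite /I (gf_eq_any leE ps_z s_eq); exact: closed_eq_le_any.
rewrite /I gf_ge_le_ne; apply: (closed_ge_le_ne nz1).
rewrite eq_le_denomE; apply: oneBz_neq0; exact: is_psD ps_t ps_zt.
Qed.
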